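(* Let $\Omega\subset\mathbb R^n$ be a bounded open set, $1<p<\infty$, let $\theta:\overline\Omega\to\mathbb R$ be Lipschitz on $\overline\Omega$, and let $a<b$. Suppose that there exists a measurable function $\Gamma:(a,b)\to[0,\infty)$ such that \[ |\nabla\theta(x)|=\Gamma(\theta(x))\qquad\text{for a.e. }x\in\{x\in\Omega:a<\theta(x)<b\}. \] Then, for almost every $t\in(a,b)$, \[ A_{p,\theta}(t)=\Gamma(t)^{p-1}S_\theta(t). \] Consequently, \[ \operatorname{cap}_{p,\theta}(a,b)=\left(\int_a^b\Gamma(t)^{-1}S_\theta(t)^{-\frac1{p-1}}\,\mathrm{d}t\right)^{1-p}, \] whenever the integral is finite.
   Context: For $t\in\mathbb R$ let $\Sigma_t=\{x\in\Omega:\theta(x)=t\}$ and $S_\theta(t)=\mathcal H^{n-1}(\Sigma_t\cap\Omega)$. The energy weight is defined for almost every $t$ by \[A_{p,\theta}(t)=\int_{\Sigma_t\cap\Omega}|\nabla\theta|^{p-1}\,\mathrm{d}\mathcal H^{n-1},\] with $\nabla\theta$ the almost everywhere defined gradient (by the coarea formula it is defined $\mathcal H^{n-1}$-a.e. on $\Sigma_t$ for a.e. $t$). Negative powers of $0$ are $+\infty$. For $v\in W^{1,1}(a,b)$ (absolutely continuous representative on $[a,b]$) set $\mathcal E_{p,\theta}(v;a,b)=\int_a^b|v'(t)|^pA_{p,\theta}(t)\,\mathrm{d}t\in[0,+\infty]$, and \[\operatorname{cap}_{p,\theta}(a,b)=\inf\{\mathcal E_{p,\theta}(v;a,b): v\in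 W^{1,1}(a,b),\ v(a)=0,\ v(b)=1,\ \mathcal E_{p,\theta}(v;a,b)<\infty\}.\] *)

(* Defs.v *)
From HB Require Import structures.
From mathcomp Require Import all_boot all_order all_algebra.
From mathcomp Require Import all_classical all_reals all_analysis.
Set Implicit Arguments.
Unset Strict Implicit.
Unset Printing Implicit Defensive.
Import Order.TTheory GRing.Theory Num.Theory.
Import numFieldNormedType.Exports.
Local Open Scope classical_set_scope.
Local Open Scope ring_scope.

(* The norm that the library puts on 'rV[R]_n is the sup norm. *)
Definition enorm (R : realType) (n : nat) (x : 'rV[R]_n) : R :=
  Num.sqrt (\sum_(i < n) x 0 i ^+ 2).

(* c : gauge of the covering sets; with c set0 = 0 and 0 <= c this is an outer
   measure. *)
Definition cover_outer (R : realType) (T : Type) (c : set T -> \bar R)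
    (A : set T) : \bar R :=
  ereal_inf [set (\sum_(k <oo) c (U k))%E |
    U in [set U : (set T)^nat | A `<=` \bigcup_k U k]].

Section cover_outer.
Local Open Scope ereal_scope.
Variables (R : realType) (T : Type) (c : set T -> \bar R).
Hypotheses (c0 : c set0 = 0) (c_ge0 : forall U, 0 <= c U).

Lemma cover_outer_ge0 A : 0 <= cover_outer c A.
Proof.
by apply: le_ereal_inf_tmp => _ [U _ <-]; apply: nneseries_ge0.
Qed.

Lemma le_cover_outer A B : A `<=` B -> cover_outer c A <= cover_outer c B.
Proof.
move=> AB; apply/ereal_inf_le_tmp => _ [U BU <-].
by exists U => //; apply: subset_trans AB BU.
Qed.

Lemma cover_outer0 : cover_outer c set0 = 0.
Proof.
apply/eqP; rewrite eq_le cover_outer_ge0 andbT.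
apply: ereal_inf_lbound; exists (fun=> set0) => //.
by rewrite eseries0.
Qed.

Lemma cover_outer_sigma_subadditive : sigma_subadditive (cover_outer c).
Proof.
move=> A; have [[i ioo]|] := pselect (exists i, cover_outer c (A i) = +oo).
  rewrite (eseries_pinfty _ _ ioo) ?leey// => n _.
  by rewrite -ltNye (lt_le_trans _ (cover_outer_ge0 _)).
rewrite -forallNE => Aoo.
apply/lee_addgt0Pr => _/posnumP[e].
rewrite (le_trans _ (epsilon_trick _ _ _))//; last first.
  by move=> n; exact: cover_outer_ge0.
have [G PG] : {G : ((set T)^nat)^nat & forall n,
    A n `<=` \bigcup_k G n k /\
    \sum_(k <oo) c (G n k) <=
      cover_outer c (A n) + (e%:num / (2 ^ n.+1)%:R)%:E}.
  apply: (@choice _ _ (fun n B => A n `<=` \bigcup_k B k /\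
    \sum_(k <oo) c (B k) <=
      cover_outer c (A n) + (e%:num / (2 ^ n.+1)%:R)%:E)) => n.
  rewrite /cover_outer; set S := (X in ereal_inf X).
  have Sfin : ereal_inf S \is a fin_num.
    rewrite ge0_fin_numE; last exact: cover_outer_ge0.
    by rewrite ltey; apply/eqP; exact: Aoo.
  have en1 : (0 < e%:num / (2 ^ n.+1)%:R)%R by [].
  have [x [B AnB cBx] xS] := lb_ereal_inf_adherent en1 Sfin.
  by exists B; split => //; rewrite cBx ltW.
apply: (@le_trans _ _ (\esum_(i in setT) (c \o uncurry G) i)).
  apply: ereal_inf_lbound => /=.
  have /card_esym/ppcard_eqP[f] := card_nat2.
  exists (uncurry G \o f).
    move=> t [i _ /(PG i).1[j _ Gt]]; exists (f^-1%FUN (i, j)) => //=.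
    by rewrite invK ?inE.
  rewrite -(esum_pred_image (c \o uncurry G) _ xpredT) ?[fun=> _]set_true//;
    last by move=> n _; exact: c_ge0.
  by rewrite image_eq.
rewrite (_ : esum _ _ = \sum_(i <oo) \sum_(j <oo) c (G i j)); last first.
  pose J : nat -> set (nat * nat) := fun i => [set (i, j) | j in setT].
  rewrite (_ : setT = \bigcup_k J k); last first.
    by rewrite predeqE => -[a b]; split => // _; exists a => //; exists b.
  rewrite esum_bigcupT /=; last 2 first.
    - apply/trivIsetP => i j _ _ ij.
      rewrite predeqE => -[n m] /=; split => //= -[] [_] _ [<-{n} _].
      by move=> [m' _] [] /esym/eqP; rewrite (negbTE ij).
    - by move=> /= [n m]; exact: c_ge0.
  rewrite -(image_id [set: nat]) -fun_true esum_pred_image//; last first.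
    by move=> n _; exact: esum_ge0.
  apply: eq_eseriesr => /= j _.
  rewrite -(esum_pred_image (c \o uncurry G) (pair j) predT)//=; last first.
    by move=> ? ? _ _; exact: (@can_inj _ _ _ snd).
  by congr esum; rewrite predeqE => -[a b]; split; move=> [i _ <-]; exists i.
apply: lee_nneseries => [n _ _|n _]; last exact: (PG n).2.
by apply: nneseries_ge0.
Qed.

End cover_outer.

Definition cube (R : realType) (n : nat) (x : 'rV[R]_n) (r : R) :
    set 'rV[R]_n :=
  [set y | forall i, x 0 i <= y 0 i <= x 0 i + r].

(* r ^ n on a cube of side r, +oo on a nonempty set that is not a cube *)
Definition cube_volume (R : realType) (n : nat) (U : set 'rV[R]_n) : \bar R :=
  if U == set0 then 0%E else
  ereal_inf [set (r ^+ n)%:E |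
    r in [set r : R | 0 <= r /\ exists x, U = cube x r]].

Definition lebesgue_outer (R : realType) (n : nat) :
    set 'rV[R]_n -> \bar R :=
  cover_outer (@cube_volume R n).

Lemma cube_volume0 (R : realType) n : @cube_volume R n set0 = 0%E.
Proof. by rewrite /cube_volume eqxx. Qed.

Lemma cube_volume_ge0 (R : realType) n (U : set 'rV[R]_n) :
  (0 <= cube_volume U)%E.
Proof.
rewrite /cube_volume; case: ifPn => // _.
by apply: le_ereal_inf_tmp => _ [r [r0 _] <-]; rewrite lee_fin exprn_ge0.
Qed.

HB.instance Definition _ (R : realType) (n : nat) :=
  isOuterMeasure.Build R 'rV[R]_n (@lebesgue_outer R n)
    (cover_outer0 (@cube_volume0 R n) (@cube_volume_ge0 R n))
    (cover_outer_ge0 (@cube_volume_ge0 R n))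
    (@le_cover_outer R _ (@cube_volume R n))
    (cover_outer_sigma_subadditive (@cube_volume_ge0 R n)).

(* The Caratheodory sigma-algebra of lebesgue_outer is that of the Lebesgue
   measurable sets. *)
Definition lebesgueRn (R : realType) (n : nat) :
    set (caratheodory_type (@lebesgue_outer R n)) -> \bar R :=
  @lebesgue_outer R n.
Arguments lebesgueRn : clear implicits.
HB.instance Definition _ (R : realType) (n : nat) :=
  isMeasure.Build _ _ _ (@lebesgueRn R n)
    (@caratheodory_measure0 _ _ (@lebesgue_outer R n))
    (@caratheodory_measure_ge0 _ _ (@lebesgue_outer R n))
    (@caratheodory_measure_sigma_additive _ _ (@lebesgue_outer R n)).

Definition diam (R : realType) (n : nat) (U : set 'rV[R]_n) : \bar R :=
  ereal_sup [set (enorm (xy.1 - xy.2))%:E | xy in U `*` U].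

(* pi ^ (m / 2) / Gamma (m / 2 + 1) *)
Fixpoint unit_ball_volume (R : realType) (m : nat) : R :=
  match m with
  | 0 => 1
  | 1 => 2
  | (k.+1 as j).+1 => 2 * pi / j.+1%:R * unit_ball_volume R k
  end.

(* For m = 0 a nonempty set has gauge 1, because 0 ^+ 0 = 1. *)
Definition hausdorff_gauge (R : realType) (n m : nat) (delta : R)
    (U : set 'rV[R]_n) : \bar R :=
  if U == set0 then 0%E
  else if (diam U <= delta%:E)%E
  then ((unit_ball_volume R m)%:E * (diam U * (2^-1)%:E) ^+ m)%E
  else +oo%E.

Definition hausdorff_outer (R : realType) (n m : nat) (A : set 'rV[R]_n) :
    \bar R :=
  ereal_sup [set cover_outer (hausdorff_gauge m delta) A |
    delta in [set delta : R | 0 < delta]].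

Section hausdorff_outer.
Local Open Scope ereal_scope.
Variables (R : realType) (n m : nat).

Lemma unit_ball_volume_gt0 k : (0 < unit_ball_volume R k)%R.
Proof.
suff : (0 < unit_ball_volume R k)%R /\ (0 < unit_ball_volume R k.+1)%R by case.
elim: k => [|k [k0 k1]]; first by split; rewrite /= ?ltr01 ?ltr0n.
split => //; rewrite [unit_ball_volume _ _]/= mulr_gt0// divr_gt0//.
by rewrite mulr_gt0// pi_gt0.
Qed.

Lemma hausdorff_gauge0 delta : @hausdorff_gauge R n m delta set0 = 0.
Proof. by rewrite /hausdorff_gauge eqxx. Qed.

Lemma diam_ge0 (U : set 'rV[R]_n) : U !=set0 -> 0 <= diam U.
Proof.
move=> [x Ux]; apply: ereal_sup_ubound; exists (x, x) => //=.
by rewrite subrr /enorm big1 ?sqrtr0// => i _; rewrite mxE expr0n.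
Qed.

Lemma hausdorff_gauge_ge0 delta (U : set 'rV[R]_n) :
  0 <= hausdorff_gauge m delta U.
Proof.
rewrite /hausdorff_gauge; case: ifPn => // /set0P U0; case: ifPn => // _.
rewrite mule_ge0 ?lee_fin ?(ltW (unit_ball_volume_gt0 _))//.
by rewrite expe_ge0// mule_ge0 ?diam_ge0// lee_fin invr_ge0.
Qed.

Lemma hausdorff_outer_ge0 A : 0 <= @hausdorff_outer R n m A.
Proof.
apply: (@le_trans _ _ (cover_outer (hausdorff_gauge m 1) A)).
  by apply: cover_outer_ge0; exact: hausdorff_gauge_ge0.
by apply: ereal_sup_ubound; exists 1%R => //=.
Qed.

Lemma hausdorff_outer0 : @hausdorff_outer R n m set0 = 0.
Proof.
apply/eqP; rewrite eq_le hausdorff_outer_ge0 andbT.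
apply: ge_ereal_sup => _ [delta _ <-].
by rewrite cover_outer0//; [exact: hausdorff_gauge0|exact: hausdorff_gauge_ge0].
Qed.

Lemma le_hausdorff_outer A B :
  A `<=` B -> @hausdorff_outer R n m A <= hausdorff_outer m B.
Proof.
move=> AB; apply: ge_ereal_sup => _ [delta delta0 <-].
apply: (le_trans (le_cover_outer _ AB)).
by apply: ereal_sup_ubound; exists delta.
Qed.

Lemma hausdorff_outer_sigma_subadditive :
  sigma_subadditive (@hausdorff_outer R n m).
Proof.
move=> A; apply: ge_ereal_sup => _ [delta delta0 <-].
have g0 := @hausdorff_gauge_ge0 delta.
apply: (le_trans (cover_outer_sigma_subadditive g0 A)).
apply: lee_nneseries => [k _ _|k _]; first exact: cover_outer_ge0.
by apply: ereal_sup_ubound; exists delta.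
Qed.

End hausdorff_outer.

HB.instance Definition _ (R : realType) (n m : nat) :=
  isOuterMeasure.Build R 'rV[R]_n (@hausdorff_outer R n m)
    (@hausdorff_outer0 R n m) (@hausdorff_outer_ge0 R n m)
    (@le_hausdorff_outer R n m) (@hausdorff_outer_sigma_subadditive R n m).

(* restricted to sets measurable in the sense of Caratheodory, which include the
   Borel sets *)
Definition hausdorff (R : realType) (n m : nat) :
    set (caratheodory_type (@hausdorff_outer R n m)) -> \bar R :=
  @hausdorff_outer R n m.
Arguments hausdorff : clear implicits.
HB.instance Definition _ (R : realType) (n m : nat) :=
  isMeasure.Build _ _ _ (@hausdorff R n m)
    (@caratheodory_measure0 _ _ (@hausdorff_outer R n m))
    (@caratheodory_measure_ge0 _ _ (@hausdorff_outer R n m))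
    (@caratheodory_measure_sigma_additive _ _ (@hausdorff_outer R n m)).

(* 'd theta x is a default linear map where theta is not differentiable. *)
Definition gradient (R : realType) (n : nat) (theta : 'rV[R]_n -> R)
    (x : 'rV[R]_n) : 'rV[R]_n :=
  \row_i 'd theta x (delta_mx 0 i).

Definition level_set (R : realType) (n : nat) (Omega : set 'rV[R]_n)
    (theta : 'rV[R]_n -> R) (t : R) : set 'rV[R]_n :=
  [set x | Omega x /\ theta x = t].

Definition level_area (R : realType) (n : nat) (Omega : set 'rV[R]_n)
    (theta : 'rV[R]_n -> R) (t : R) : \bar R :=
  hausdorff R n n.-1 (level_set Omega theta t).

Definition energy_weight (R : realType) (n : nat) (Omega : set 'rV[R]_n)
    (theta : 'rV[R]_n -> R) (p t : R) : \bar R :=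
  (\int[hausdorff R n n.-1]_(x in level_set Omega theta t)
     (enorm (gradient theta x) `^ (p - 1))%:E)%E.

(* the sigma-algebra of Lebesgue measurable subsets of R, as opposed to the
   Borel one carried by R itself *)
Notation lebesgue_type R :=
  (caratheodory_type (mu_ext (@wlength R idfun))).

(* C^1_c(]a, b[): these test functions define the same weak derivatives as
   C^oo_c(]a, b[) (Brezis, Functional Analysis, Sobolev Spaces and PDE, 8.2). *)
Definition test_function (R : realType) (a b : R) (phi : R -> R) : Prop :=
  [/\ forall x, derivable phi x 1, continuous (derive1 phi) &
    exists c d, [/\ a < c, d < b & forall x, x \notin `[c, d] -> phi x = 0]].

Definition weak_derivative (R : realType) (a b : R) (v g : R -> R) : Prop :=
  forall phi, test_function a b phi ->
    \int[lebesgue_measure]_(x in `]a, b[) (v x * derive1 phi x) =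
    - \int[lebesgue_measure]_(x in `]a, b[) (g x * phi x).

(* v in W^{1,1}(]a, b[), with weak derivative g *)
Definition sobolev11 (R : realType) (a b : R) (v g : R -> R) : Prop :=
  [/\ lebesgue_measure.-integrable `]a, b[ (EFin \o v),
      lebesgue_measure.-integrable `]a, b[ (EFin \o g) &
      weak_derivative a b v g].

Definition abs_continuous (R : realType) (a b : R) (v : R -> R) : Prop :=
  forall e : R, 0 < e -> exists2 d : R, 0 < d &
    forall (N : nat) (x y : 'I_N -> R),
      (forall i, [/\ a <= x i, x i <= y i & y i <= b]) ->
      trivIset setT (fun i => `]x i, y i[%classic) ->
      \sum_(i < N) (y i - x i) < d ->
      \sum_(i < N) `|v (y i) - v (x i)| < e.

(* The weak derivative g stands for v'. *)
Definition energy (R : realType) (n : nat) (Omega : set 'rV[R]_n)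
    (theta : 'rV[R]_n -> R) (p a b : R) (g : R -> R) : \bar R :=
  (\int[lebesgue_measure]_(t in `]a, b[)
     ((`|g t| `^ p)%:E * energy_weight Omega theta p t))%E.

Definition capacity (R : realType) (n : nat) (Omega : set 'rV[R]_n)
    (theta : 'rV[R]_n -> R) (p a b : R) : \bar R :=
  ereal_inf [set e : \bar R | exists v g : R -> R,
    [/\ sobolev11 a b v g /\ abs_continuous a b v,
        v a = 0, v b = 1,
        e = energy Omega theta p a b g & (e < +oo)%E]].

(* x ^ (- s) for s > 0, with 0 ^ (- s) = +oo and +oo ^ (- s) = 0; the library's
   powers give 0 and +oo respectively for these. *)
Definition neg_power (R : realType) (x : \bar R) (s : R) : \bar R :=
  ((x `^ s)^-1)%E.

(* Main.v *)
Require Import Defs.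
From HB Require Import structures.
From mathcomp Require Import all_boot all_order all_algebra.
From mathcomp Require Import all_classical all_reals all_analysis.
From mathcomp Require Import measurable_realfun zify ring lra.
Set Implicit Arguments.
Unset Strict Implicit.
Unset Printing Implicit Defensive.
Import Order.TTheory GRing.Theory Num.Theory.
Import numFieldNormedType.Exports.
Local Open Scope classical_set_scope.
Local Open Scope ring_scope.

(* Covering an exceptional set of measure zero by small cubes and integrating
   the resulting bound over t (Eilenberg's inequality) shows that almost every
   level set meets it in an H^(n-1)-null set; on such a level set |grad theta|
   is the constant Gamma(t), which gives A(t) = Gamma(t)^(p-1) S(t).  For the
   capacity, put k = Gamma^-1 S^(-1/(p-1)) = A^(-1/(p-1)) and u = k / int k.
   Bernoulli's inequality x^p >= p x - (p - 1), applied to x = |v'| / u, gives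
   |v'|^p A >= (int k)^(1-p) (p |v'| - (p - 1) u), and integrating this with
   int |v'| >= v(b) - v(a) = 1 bounds the energy below by (int k)^(1-p); the
   primitive of u attains the bound.  S has to be measurable for these integrals
   to behave: for compact K, t |-> H^m(K n theta^-1(t)) is a supremum of
   functions that are upper semicontinuous up to a change of scale. *)

(** No coarea formula enters: the identity for the weight needs only that null sets have null
    slices, and the capacity needs, besides measurability of [S], only that [S] is finite almost
    everywhere; both come from one covering estimate. Two measurability gaps shape the rest.
    [gradient theta] is not known to be measurable, so weights are compared through integrals of
    nonnegative functions that agree almost everywhere. [Gamma] is only Lebesgue measurable, so a
    Borel function replaces it under the integral. Zeros of the weight make the integrand of [I]
    infinite; finiteness of [I] confines them to a null set, where [k] may be given any positive
    value. On the Sobolev side the derivative is weak, so the identity int v' = v(b) - v(a) must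
    itself be extracted from the definition by suitable test functions. *)

Section ae_eq_ge0_integral.
Import HBNNSimple.

(* No measurability is required: for a nonnegative function the integral is a
   supremum over simple functions, which can be cut off on the null set. *)
Lemma ae_eq_ge0_integral d (T : measurableType d) (R : realType)
    (mu : {measure set T -> \bar R}) (D : set T) (f g : T -> \bar R) :
  (forall x, D x -> (0 <= f x)%E) -> (forall x, D x -> (0 <= g x)%E) ->
  {ae mu, forall x, D x -> f x = g x} ->
  (\int[mu]_(x in D) f x = \int[mu]_(x in D) g x)%E.
Proof.
move=> f0 g0 fg; apply/eqP; rewrite eq_le.
wlog suff le_fg : f g f0 g0 fg /
    (\int[mu]_(x in D) f x <= \int[mu]_(x in D) g x)%E.
  by apply/andP; split; apply: le_fg => //; apply: filterS fg => x fg /fg.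
case: fg => N [mN N0 fgN].
rewrite !ge0_integralE//; apply: ge_ereal_sup => _ [h hf <-].
have mCN := measurableC mN.
have -> : sintegral mu h = sintegral mu (proj_nnsfun h mCN).
  rewrite -mrestrict -integral_nnsfun//.
  transitivity (\int[mu]_x (h x)%:E)%E.
    by rewrite integral_nnsfun// patch_setT.
  rewrite (@ge0_negligible_integral _ _ _ mu setT N)// ?setTD//.
    exact/measurable_EFinP.
  by move=> x _; rewrite lee_fin.
apply: ereal_sup_ubound; exists (proj_nnsfun h mCN) => // x.
rewrite -mrestrict patchE; case: ifPn => [xN|_]; last first.
  by rewrite patchE; case: ifPn => // /set_mem /g0.
apply: le_trans (hf x) _; rewrite !patchE; case: ifPn => // /set_mem Dx.
suff -> : f x = g x by [].
by apply: contrapT => fgx; move: (set_mem xN); apply; apply: fgN => /(_ Dx).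
Qed.

End ae_eq_ge0_integral.

(** Caratheodory's criterion. The neighbourhoods [U k] shrink to [C], and [X] outside [C] splits
    into the part outside [U k.+1] and the thin shells [Q j] with [j >= k]. Shells whose indices
    differ by at least two are separated, so those of each parity have total mass at most [mu X];
    the series converges and its tails vanish. The part outside [U k.+1] is separated from [C]. *)
Lemma metric_closed_caratheodory (R : realType) (V : normedModType R)
    (mu : {outer_measure set V -> \bar R}) :
  (forall (A B : set V) (e : R), 0 < e ->
    (forall x y, A x -> B y -> e <= `|x - y|) ->
    (mu A + mu B <= mu (A `|` B))%E) ->
  forall C : set V, closed C -> mu.-caratheodory C.
Proof.
move=> mu_sep C clC; apply: le_caratheodory_measurable => X.
have [->|Xoo] := eqVneq (mu X) +oo%E; first exact: leey.
pose U k := [set x : V | exists2 y, C y & `|x - y| < k.+1%:R^-1].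
have US k m : (k <= m)%N -> U m `<=` U k.
  move=> km x [y Cy xy]; exists y => //; apply: lt_le_trans xy _.
  by rewrite lef_pV2 ?posrE// ler_nat.
have U_sep k (A B : set V) : A `<=` ~` U k -> B `<=` U k.+1 ->
    (mu A + mu B <= mu (A `|` B))%E.
  move=> AU BU; apply: (mu_sep _ _ (k.+1%:R^-1 - k.+2%:R^-1)).
    by rewrite subr_gt0 ltf_pV2 ?posrE// ltr_nat.
  move=> x z /AU Ux /BU[y Cy zy]; rewrite lerBlDr.
  rewrite leNgt; apply/negP => xz; apply: Ux; exists y => //.
  by apply: le_lt_trans (ler_distD z x y) _; apply: lt_trans xz; rewrite ltrD2l.
have {}muXS A : A `<=` X -> (mu A <= mu X)%E.
  by move=> ?; exact: le_outer_measure.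
pose Q k := X `&` (U k.+1 `\` U k.+2).
have sumQ i N : (\sum_(j < N) mu (Q (j.*2 + i)%N) <=
    mu (X `&` ~` U (N.*2 + i)%N))%E.
  elim: N => [|N IH]; first by rewrite big_ord0.
  rewrite big_ord_recr/=; apply: le_trans (leeD2r _ IH) _.
  apply: le_trans (U_sep (N.*2 + i)%N _ _ _ _) _.
  - by move=> x [].
  - by move=> x [_ []].
  - apply: le_outer_measure => x [[Xx Ux]|[Xx [_ Ux]]]; split => //.
    by move=> Ux'; apply: Ux; apply: US Ux'; rewrite doubleS; lia.
have sumQ2 N : (\sum_(j < N) mu (Q j) <= mu X + mu X)%E.
  apply: (@le_trans _ _ (\sum_(j < N.*2) mu (Q j))%E).
    have NN : (N <= N.*2)%N by rewrite -addnn leq_addl.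
    exact: (@lee_sum_nneg_ord _ (fun j => mu (Q j)) xpredT _ _ _ NN).
  apply: (@le_trans _ _ (\sum_(j < N) mu (Q (j.*2 + 0)%N) +
                         \sum_(j < N) mu (Q (j.*2 + 1)%N))%E); last first.
    by apply: leeD; apply: le_trans (sumQ _ _) _; apply: muXS.
  elim: N => [|N IH]; first by rewrite !big_ord0 adde0.
  by rewrite doubleS !big_ord_recr/= addn0 addn1 addeACA addeA leeD2r// leeD2r.
have Qoo : (\sum_(j <oo) mu (Q j) < +oo)%E.
  apply: (@le_lt_trans _ _ (mu X + mu X)%E); last first.
    by rewrite lte_add_pinfty// ltey.
  apply: lime_le; first by apply: is_cvg_nneseries.
  by near=> k; rewrite big_mkord.
have XC k : (mu (X `&` ~` C) <=
    mu (X `&` ~` U k.+1) + \sum_(k <= j <oo) mu (Q j))%E.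
  apply: le_trans (leeD2l _ (outer_measure_sigma_subadditive_tail mu k Q)).
  apply: le_trans (outer_measureU2 _ _ _); apply: le_outer_measure.
  move=> x [Xx Cx]; have [Ux|Ux] := pselect (U k.+1 x); last by left.
  (* As [C] is closed, [x] leaves the neighbourhoods at a least index [m], and then it lies in the
     shell [Q (m - 2)]. *)
  right; have [m Um] : exists m, ~ U m x.
    have /nbhs_ballP[e /= e0 xeC] : nbhs x (~` C).
      by apply: open_nbhs_nbhs; split => //; exact: closed_openC.
    have [m _ me] := near_infty_natSinv_lt (PosNum e0).
    exists m => -[y Cy xy]; apply: (xeC y) => //.
    by rewrite -ball_normE/=; apply: lt_trans xy _; exact: (me m (leqnn m)).
  have exU : exists m, `[< ~ U m x >] by exists m; exact/asboolP.
  case: (ex_minnP exU) => {Um}m /asboolP Um mP.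
  have km : (k.+2 <= m)%N.
    by rewrite ltnNge; apply/negP => mk; apply: Um; exact: US Ux.
  exists (m - 2)%N.
    by rewrite /= /mkset; apply/negP; rewrite -leqNgt leq_subRL; lia.
  have -> : Q (m - 2)%N = X `&` (U m.-1 `\` U m).
    by rewrite /Q; do 3!f_equal; lia.
  split=> //; split => //; apply: contrapT => /asboolT/mP; lia.
have tail0 := nneseries_tail_cvg Qoo (fun k _ => outer_measure_ge0 mu (Q k)).
have : (fun k => mu X + \sum_(k <= j <oo) mu (Q j))%E @ \oo --> (mu X + 0)%E.
  by apply: cvgeD => //; [rewrite fin_num_adde_defl|exact: cvg_cst].
rewrite adde0 => cvgX; rewrite -(cvg_lim _ cvgX)//; apply: lime_ge.
  by apply/cvg_ex; eexists; exact: cvgX.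
apply: nearW => k; apply: le_trans (leeD2l _ (XC k)) _; rewrite addeA leeD2r//.
apply: le_trans (mu_sep _ _ k.+2%:R^-1 _ _) (muXS _ _) => //.
  move=> x y [_ Cx] [_ Uy]; rewrite leNgt; apply/negP => xy; apply: Uy.
  by exists x => //; rewrite distrC.
by move=> x [[]|[]].
Unshelve. all: by end_near. Qed.

(** * The Euclidean norm and Hausdorff measure *)

Section enorm.
Variables (R : realType) (n : nat).
Implicit Types x y : 'rV[R]_n.

Lemma enorm_ge0 x : 0 <= enorm x.
Proof. exact: sqrtr_ge0. Qed.

Lemma sqr_enorm x : enorm x ^+ 2 = \sum_(i < n) x 0 i ^+ 2.
Proof. by rewrite sqr_sqrtr// sumr_ge0// => i _; rewrite sqr_ge0. Qed.

Lemma enormN x : enorm (- x) = enorm x.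
Proof. by congr Num.sqrt; apply: eq_bigr => i _; rewrite mxE sqrrN. Qed.

Lemma ler_coord_enorm x i : `|x 0 i| <= enorm x.
Proof.
rewrite -(ler_pXn2r (_ : 0 < 2)%N) ?nnegrE ?enorm_ge0// sqr_enorm.
rewrite real_normK ?num_real// (bigD1 i)//= lerDl.
by apply: sumr_ge0 => j _; rewrite sqr_ge0.
Qed.

Lemma enorm_eq0 x : enorm x = 0 -> x = 0.
Proof.
move=> x0; apply/rowP => i; rewrite mxE; apply/eqP.
by rewrite -normr_eq0 eq_le normr_ge0 andbT -x0 ler_coord_enorm.
Qed.

Lemma ler_norm_enorm x : `|x| <= enorm x.
Proof.
rewrite [`|x|]mx_normrE; apply/bigmax_leP; split; first exact: enorm_ge0.
by move=> [i j] _ /=; rewrite ord1 ler_coord_enorm.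
Qed.

(** The factor [n], in place of its square root, comes from [n <= n ^ 2]; constants depending only
    on the dimension do no harm in the covering estimates. *)
Lemma enorm_le x (r : R) : 0 <= r -> (forall i, `|x 0 i| <= r) ->
  enorm x <= n%:R * r.
Proof.
move=> r0 xr; have nr0 : 0 <= n%:R * r by rewrite mulr_ge0.
rewrite -(ler_pXn2r (_ : 0 < 2)%N) ?nnegrE ?enorm_ge0// sqr_enorm.
apply: (@le_trans _ _ (\sum_(i < n) r ^+ 2)).
  apply: ler_sum => i _.
  by rewrite -ler_sqrt ?sqr_ge0// !sqrtr_sqr (ger0_norm r0).
rewrite sumr_const card_ord exprMn -[leLHS]mulr_natl ler_wpM2r ?sqr_ge0//.
by rewrite -natrX ler_nat; case: (n) => // k; rewrite expnS leq_pmulr.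
Qed.

Lemma enorm_le_norm x : enorm x <= n%:R * `|x|.
Proof.
apply: enorm_le => // i; rewrite [leRHS]mx_normrE.
by apply: (le_bigmax _ (fun ij => `|x ij.1 ij.2|) (0, i)).
Qed.

(** Young's inequality 2xy <= x^2/r + r y^2 in each coordinate, with the weight
    [r = enorm x / enorm y] for which the sum is exactly the square of [enorm x + enorm y]. *)
Lemma ler_enormD x y : enorm (x + y) <= enorm x + enorm y.
Proof.
have [/enorm_eq0 ->|x0] := eqVneq (enorm x) 0.
  by rewrite add0r lerDr enorm_ge0.
have [/enorm_eq0 ->|y0] := eqVneq (enorm y) 0.
  by rewrite addr0 lerDl enorm_ge0.
have {}x0 : 0 < enorm x by rewrite lt_def x0 enorm_ge0.
have {}y0 : 0 < enorm y by rewrite lt_def y0 enorm_ge0.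
rewrite -(ler_pXn2r (_ : 0 < 2)%N) ?nnegrE ?addr_ge0 ?enorm_ge0//.
set r := enorm x / enorm y; have r0 : 0 < r by rewrite divr_gt0.
rewrite sqr_enorm.
apply: (@le_trans _ _ (\sum_(i < n)
    ((1 + r^-1) * x 0 i ^+ 2 + (1 + r) * y 0 i ^+ 2))).
  apply: ler_sum => i _; rewrite mxE -subr_ge0.
  rewrite (_ : _ - _ = (x 0 i - r * y 0 i) ^+ 2 / r); last first.
    by field; rewrite gt_eqF.
  by rewrite divr_ge0 ?sqr_ge0// ltW.
rewrite big_split/= -!mulr_sumr -!sqr_enorm le_eqVlt; apply/orP; left.
by apply/eqP; rewrite /r; field; rewrite !gt_eqF.
Qed.

End enorm.

Section hausdorff_gauge.
Local Open Scope ereal_scope.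
Variables (R : realType) (n m : nat).
Implicit Types (U V : set 'rV[R]_n) (delta : R).

Lemma lee_expe (x y : \bar R) k : 0 <= x -> x <= y -> x ^+ k <= y ^+ k.
Proof.
move=> x0 xy; elim: k => [|k IH]; first by rewrite !expe0.
by rewrite !expeS; apply: lee_pmul => //; exact: expe_ge0.
Qed.

Lemma le_diam U V : U `<=` V -> diam U <= diam V.
Proof.
move=> UV; apply: ge_ereal_sup => _ [[x y] [/UV Ux /UV Uy] <-].
by apply: ereal_sup_ubound; exists (x, y).
Qed.

Lemma diam_leP U (d : R) : (forall x y, U x -> U y -> (enorm (x - y) <= d)%R) ->
  diam U <= d%:E.
Proof.
by move=> Ud; apply: ge_ereal_sup => _ [[x y] [Ux Uy] <-]; rewrite lee_fin Ud.
Qed.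

Lemma ge_diam U x y : U x -> U y -> (enorm (x - y))%:E <= diam U.
Proof. by move=> Ux Uy; apply: ereal_sup_ubound; exists (x, y). Qed.

Lemma hausdorff_gauge_le U V delta : U `<=` V ->
  hausdorff_gauge m delta U <= hausdorff_gauge m delta V.
Proof.
move=> UV; have [->|U0] := eqVneq U set0.
  by rewrite hausdorff_gauge0 hausdorff_gauge_ge0.
have VN0 : V != set0.
  by apply/set0P; move/set0P : U0 => [x /UV Vx]; exists x.
rewrite /hausdorff_gauge (negbTE U0) (negbTE VN0).
case: (leP (diam V) _) => [Vd|_]; last exact: leey.
rewrite (le_trans (le_diam UV) Vd); apply: lee_wpmul2l.
  by rewrite lee_fin ltW// unit_ball_volume_gt0.
have /set0P/diam_ge0 dU0 := U0.
apply: lee_expe; first by rewrite mule_ge0// lee_fin invr_ge0.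
by apply: lee_wpmul2r; [rewrite lee_fin invr_ge0|exact: le_diam].
Qed.

Lemma hausdorff_gauge_delta U delta delta' : (delta' <= delta)%R ->
  hausdorff_gauge m delta U <= hausdorff_gauge m delta' U.
Proof.
move=> dd; rewrite /hausdorff_gauge; case: ifPn => // _.
case: (leP (diam U) delta'%:E) => [Ud|_]; last exact: leey.
by rewrite (le_trans Ud)// lee_fin.
Qed.

Lemma hausdorff_gauge_ub U (d delta : R) : (0 <= d <= delta)%R ->
  (forall x y, U x -> U y -> (enorm (x - y) <= d)%R) ->
  hausdorff_gauge m delta U <= (unit_ball_volume R m * (d / 2) ^+ m)%:E.
Proof.
move=> /andP[d0 dd] /diam_leP Ud.
have u0 := ltW (unit_ball_volume_gt0 R m).
have [->|U0] := eqVneq U set0.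
  by rewrite hausdorff_gauge0 lee_fin mulr_ge0// exprn_ge0// divr_ge0.
rewrite /hausdorff_gauge (negbTE U0) (le_trans Ud) ?lee_fin// EFinM.
have /set0P/diam_ge0 dU0 := U0.
apply: lee_wpmul2l; first by rewrite lee_fin.
rewrite EFin_expe; apply: lee_expe.
  by rewrite mule_ge0// lee_fin invr_ge0.
by rewrite EFinM; apply: lee_wpmul2r => //; rewrite lee_fin invr_ge0.
Qed.

Lemma cover_outer_delta delta delta' A : (delta' <= delta)%R ->
  cover_outer (hausdorff_gauge m delta) A <=
  cover_outer (@hausdorff_gauge R n m delta') A.
Proof.
move=> dd; apply: le_ereal_inf_tmp => _ [U AU <-].
apply: (@le_trans _ _ (\sum_(k <oo) hausdorff_gauge m delta (U k))).
  by apply: ereal_inf_lbound; exists U.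
apply: lee_nneseries => k _; first by move=> _; exact: hausdorff_gauge_ge0.
exact: hausdorff_gauge_delta.
Qed.

(** A covering set that meets both [A] and [B] has diameter at least [e > delta], hence gauge +oo.
    Any other set serves at most one side, so a cover of the union splits without loss. *)
Lemma cover_outer_sep (A B : set 'rV[R]_n) (e delta : R) : (delta < e)%R ->
  (forall x y, A x -> B y -> (e <= `|x - y|)%R) ->
  cover_outer (hausdorff_gauge m delta) A +
  cover_outer (hausdorff_gauge m delta) B <=
  cover_outer (hausdorff_gauge m delta) (A `|` B).
Proof.
move=> de AB; apply: le_ereal_inf_tmp => _ [U ABU <-].
apply: (@le_trans _ _ (\sum_(k <oo) (hausdorff_gauge m delta (U k `&` A) +
                                     hausdorff_gauge m delta (U k `&` B)))).
  rewrite nneseriesD; try by move=> *; exact: hausdorff_gauge_ge0.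
  apply: leeD.
    apply: ereal_inf_lbound; exists (fun k => U k `&` A) => // x Ax.
    by have [k _ Ukx] := ABU x (or_introl Ax); exists k.
  apply: ereal_inf_lbound; exists (fun k => U k `&` B) => // x Bx.
  by have [k _ Ukx] := ABU x (or_intror Bx); exists k.
apply: lee_nneseries => k _.
  by move=> _; apply: adde_ge0; exact: hausdorff_gauge_ge0.
have [->|/set0P[x [Ux Ax]]] := eqVneq (U k `&` A) set0.
  by rewrite hausdorff_gauge0 add0e; apply: hausdorff_gauge_le => y [].
have [->|/set0P[y [Uy By]]] := eqVneq (U k `&` B) set0.
  by rewrite hausdorff_gauge0 adde0; apply: hausdorff_gauge_le => z [].
rewrite [leRHS]/hausdorff_gauge; case: ifPn => [/eqP U0|_].
  by move: Ux; rewrite U0.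
case: ifPn => [Ud|_]; last exact: leey.
have := le_trans (ge_diam Ux Uy) Ud; rewrite lee_fin.
move/(le_trans (ler_norm_enorm _))/(le_trans (AB _ _ Ax By)).
by rewrite leNgt de.
Qed.

Lemma hausdorff_outer_sep (A B : set 'rV[R]_n) (e : R) : (0 < e)%R ->
  (forall x y, A x -> B y -> (e <= `|x - y|)%R) ->
  hausdorff_outer m A + hausdorff_outer m B <= hausdorff_outer m (A `|` B).
Proof.
move=> e0 AB.
have [->|ABoo] := eqVneq (hausdorff_outer m (A `|` B)) +oo; first exact: leey.
have finAB (C : set 'rV[R]_n) : C `<=` A `|` B ->
    hausdorff_outer m C \is a fin_num.
  move=> CAB; rewrite ge0_fin_numE ?hausdorff_outer_ge0//.
  by apply: le_lt_trans (le_hausdorff_outer _ CAB) _; rewrite ltey.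
rewrite -leeBrDr ?finAB//; apply: ge_ereal_sup => _ [d1 /= d10 <-].
rewrite leeBrDr ?finAB// addeC -leeBrDr; last first.
  rewrite ge0_fin_numE; last first.
    by apply: cover_outer_ge0; exact: hausdorff_gauge_ge0.
  apply: (@le_lt_trans _ _ (hausdorff_outer m A)).
    by apply: ereal_sup_ubound; exists d1.
  by rewrite -ge0_fin_numE ?hausdorff_outer_ge0// finAB.
apply: ge_ereal_sup => _ [d2 /= d20 <-].
rewrite leeBrDr; last first.
  rewrite ge0_fin_numE; last first.
    by apply: cover_outer_ge0; exact: hausdorff_gauge_ge0.
  apply: (@le_lt_trans _ _ (hausdorff_outer m A)).
    by apply: ereal_sup_ubound; exists d1.
  by rewrite -ge0_fin_numE ?hausdorff_outer_ge0// finAB.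
(* By monotonicity in the scale, one [d] serves both suprema; [e / 2] keeps it below the
   separation. *)
pose d := Num.min (e / 2)%R (Num.min d1 d2).
have d0 : (0 < d)%R by rewrite !lt_min divr_gt0 ?d10 ?d20.
apply: (@le_trans _ _ (cover_outer (hausdorff_gauge m d) (A `|` B))).
  apply: le_trans (cover_outer_sep (_ : d < e)%R AB); last first.
    by rewrite gt_min ltr_pdivrMr// ltr_pMr// ltr1n.
  rewrite addeC; apply: leeD; apply: cover_outer_delta.
    by rewrite !ge_min lexx orbT.
  by rewrite !ge_min lexx !orbT.
by apply: ereal_sup_ubound; exists d.
Qed.

Lemma closed_hausdorff_measurable (C : set 'rV[R]_n) : closed C ->
  (@hausdorff_outer R n m).-caratheodory C.
Proof.
move=> clC; apply: metric_closed_caratheodory clC => A B e.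
exact: hausdorff_outer_sep.
Qed.

Lemma open_hausdorff_measurable (C : set 'rV[R]_n) : open C ->
  (@hausdorff_outer R n m).-caratheodory C.
Proof.
move=> oC; rewrite -(setCK C); apply: caratheodory_measurable_setC.
by apply: closed_hausdorff_measurable; exact: open_closedC.
Qed.

End hausdorff_gauge.

(** * Slices of small sets *)

Section eilenberg.
Local Open Scope ereal_scope.
Variables (R : realType) (n : nat) (theta : 'rV[R]_n -> R) (A : set 'rV[R]_n).
Variable L : R.
Hypotheses (n0 : (0 < n)%N) (L0 : (0 <= L)%R).
Hypothesis thetaL : forall x y, A x -> A y ->
  (`|theta x - theta y| <= L * enorm (x - y))%R.

Let mu := @lebesgue_measure R.
Let omega := unit_ball_volume R n.-1.

(** For an arbitrary [A] the slices need not have measurable area, so a measurable majorant is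
    built. A set of diameter at most [d k] meets only levels in an interval of length [2 * L * d k],
    and each of its slices has gauge at most [w k]; the product is at most [2 * L * omega * d k ^ n]
    once the powers of 1/2 are dropped. If [U k] misses [A], the centre [c k] is a default value,
    which only adds to the majorant. *)
Lemma slice_cover (U : (set 'rV[R]_n)^nat) (d : nat -> R) (delta : R) :
  (forall k, 0 <= d k <= delta)%R -> A `<=` \bigcup_k U k ->
  (forall k x y, U k x -> U k y -> (enorm (x - y) <= d k)%R) ->
  exists f : R -> \bar R, [/\ measurable_fun setT f, forall t, 0 <= f t,
    \int[mu]_t f t <= (2 * L * omega)%:E * \sum_(k <oo) (d k ^+ n)%:E &
    forall t, cover_outer (hausdorff_gauge n.-1 delta)
      (A `&` theta @^-1` [set t]) <= f t].
Proof.
move=> dk AU Ud.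
have d0 k : (0 <= d k)%R by have /andP[] := dk k.
have omega0 : (0 <= omega)%R by exact/ltW/unit_ball_volume_gt0.
pose c k := theta (xget (0%R : 'rV[R]_n) (U k `&` A)).
pose I k := `[(c k - L * d k)%R, (c k + L * d k)%R]%classic : set R.
pose w k := (omega * (d k / 2) ^+ n.-1)%R.
have w0 k : (0 <= w k)%R by rewrite mulr_ge0// exprn_ge0// divr_ge0.
have mI k : measurable (I k) by exact: measurable_itv.
pose h k (t : R) := (w k)%:E * (\1_(I k) t)%:E.
have h0 k t : 0 <= h k t by rewrite mule_ge0 ?lee_fin.
have mI1 k : measurable_fun setT (fun t : R => (\1_(I k) t : R)%:E).
  by apply/measurable_EFinP; exact: measurable_indic.
have mh k : measurable_fun setT (h k).
  by apply: emeasurable_funM => //; exact: measurable_cst.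
exists (fun t => \sum_(k <oo) h k t); split.
- by apply: ge0_emeasurable_sum.
- by move=> t; apply: nneseries_ge0.
- rewrite integral_nneseries// -nneseriesZl; last first.
    by move=> k _; rewrite lee_fin exprn_ge0.
  apply: lee_nneseries => k _; first by move=> _; apply: integral_ge0.
  rewrite ge0_integralZl_EFin//; last first.
    exact: mI1.
  have -> : \int[mu]_t (\1_(I k) t)%:E = mu (I k).
    by rewrite integral_indic ?setIT; [|exact: measurableT|exact: mI].
  rewrite [mu _]lebesgue_measure_itv/= lte_fin.
  have ? : (0 <= 2 * L * omega * d k ^+ n)%R.
    by rewrite !mulr_ge0// exprn_ge0.
  case: ifPn => _; last by rewrite mule0 -EFinM lee_fin.
  rewrite -EFinB -!EFinM lee_fin /w.
  rewrite (_ : (_ - _)%R = (2 * L * d k)%R); last by ring.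
  rewrite -[in leRHS](prednK n0) exprSr.
  rewrite [leRHS](_ : _ = ((omega * d k ^+ n.-1) * (2 * L * d k))%R);
    last by ring.
  rewrite ler_wpM2r ?mulr_ge0// ler_wpM2l// lerXn2r ?nnegrE ?divr_ge0//.
  by rewrite ler_pdivrMr// ler_peMr// ler1n.
- move=> t; set At := A `&` _.
  apply: (@le_trans _ _
      (\sum_(k <oo) hausdorff_gauge n.-1 delta (U k `&` At))).
    apply: ereal_inf_lbound; exists (fun k => U k `&` At) => // x Atx.
    by have [k _ Ukx] := AU x Atx.1; exists k.
  apply: lee_nneseries => k _; first by move=> _; exact: hausdorff_gauge_ge0.
  have [->|/set0P[x [Ux [Ax tx]]]] := eqVneq (U k `&` At) set0.
    by rewrite hausdorff_gauge0.
  have -> : h k t = (w k)%:E.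
    rewrite /h indicE mem_set ?mule1// /I/= in_itv/=.
    have UA : (U k `&` A) !=set0 by exists x.
    have /(xgetPex (0%R : 'rV[R]_n))[Uy Ay] := UA.
    rewrite -ler_distlC -tx distrC.
    by apply: le_trans (thetaL Ax Ay) _; rewrite ler_wpM2l// Ud.
  by apply: hausdorff_gauge_ub => // y z [Uy _] [Uz _]; exact: Ud.
Qed.

(** The majorants at the scales 1/(j+1) need not be monotone in j, so [F] is their lower limit:
    Fatou's lemma keeps the bound on the integral, and every fixed scale [delta] is eventually
    coarser than 1/(j+1), so [F] dominates the Hausdorff measure of the slice. *)
Lemma eilenberg (M : R) : (0 <= M)%R ->
  (forall delta : R, (0 < delta)%R ->
    exists (U : (set 'rV[R]_n)^nat) (d : nat -> R),
    [/\ (forall k, 0 <= d k <= delta)%R, A `<=` \bigcup_k U k,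
        (forall k x y, U k x -> U k y -> (enorm (x - y) <= d k)%R) &
        \sum_(k <oo) (d k ^+ n)%:E <= (M + delta)%:E]) ->
  exists F : R -> \bar R, [/\ measurable_fun setT F, forall t, 0 <= F t,
    \int[mu]_t F t <= (2 * L * omega * M)%:E &
    forall t, hausdorff_outer n.-1 (A `&` theta @^-1` [set t]) <= F t].
Proof.
move=> M0 cov.
have omega0 : (0 <= omega)%R by exact/ltW/unit_ball_volume_gt0.
have C0 : (0 <= 2 * L * omega)%R by rewrite !mulr_ge0.
have /choice[f fP] : forall j, exists f : R -> \bar R,
    [/\ measurable_fun setT f, forall t, 0 <= f t,
    \int[mu]_t f t <= (2 * L * omega * (M + j.+1%:R^-1))%:E &
    forall t, cover_outer (hausdorff_gauge n.-1 (j.+1%:R^-1)%R)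
      (A `&` theta @^-1` [set t]) <= f t].
  move=> j; have [|U [d [dk AU Ud dM]]] := cov (j.+1%:R^-1)%R.
    by rewrite invr_gt0.
  have [f [mf f0 fi fc]] := slice_cover dk AU Ud.
  exists f; split => //; apply: le_trans fi _.
  by rewrite [leRHS]EFinM; apply: lee_wpmul2l => //; rewrite lee_fin.
exists (fun t => limn_einf (f ^~ t)); split.
- apply: (@emeasurable_fun_cvg _ _ _ _ (fun k t => einfs (f^~ t) k)).
    by apply: measurable_fun_einfs => k; have [] := fP k.
  by move=> t _; rewrite limn_einf_lim; exact: is_cvg_einfs.
- move=> t; rewrite limn_einf_lim; apply: lime_ge; first exact: is_cvg_einfs.
  apply: nearW => k; apply: le_ereal_inf_tmp => _ [i _ <-].
  by have [_ f0 _ _] := fP i.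
- apply: le_trans (fatou _ _ _ _) _ => //.
  + by move=> k; have [] := fP k.
  + by move=> k x _; have [_ f0 _ _] := fP k.
  rewrite limn_einf_lim; apply: lime_le; first exact: is_cvg_einfs.
  apply: nearW => k; apply/lee_addgt0Pr => e e0.
  have e'0 : (0 < e / (1 + 2 * L * omega))%R.
    by rewrite divr_gt0// ltr_pwDl.
  have [m _ mP] := near_infty_natSinv_lt (PosNum e'0).
  apply: (@le_trans _ _ (\int[mu]_t f (maxn k m) t)).
    by apply: ereal_inf_lbound; exists (maxn k m) => //=; rewrite leq_maxl.
  have [_ _ fi _] := fP (maxn k m); apply: le_trans fi _.
  rewrite -EFinD lee_fin mulrDr lerD2l.
  have /= /ltW := mP (maxn k m) (leq_maxr k m).
  rewrite ler_pdivlMr ?ltr_pwDl// mulrC; apply: le_trans.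
  by rewrite ler_wpM2r ?invr_ge0// lerDr.
- move=> t; apply: ge_ereal_sup => _ [delta /= delta0 <-].
  rewrite limn_einf_lim; apply: lime_ge; first exact: is_cvg_einfs.
  have [m _ mP] := near_infty_natSinv_lt (PosNum delta0).
  exists m => // k /= mk; apply: le_ereal_inf_tmp => _ [i /= ki <-].
  have [_ _ _ fc] := fP i; apply: le_trans (fc t).
  by apply: cover_outer_delta; apply: ltW; exact: mP (leq_trans mk ki).
Qed.

End eilenberg.

Section slices.
Variables (R : realType) (n : nat).
Hypothesis n0 : (0 < n)%N.
Implicit Types A B : set 'rV[R]_n.

Lemma enorm_cube (x y z : 'rV[R]_n) (r : R) :
  cube x r y -> cube x r z -> enorm (y - z) <= n%:R * r.
Proof.
move=> xy xz; have r0 : 0 <= r.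
  by have /andP[? ?] := xy (Ordinal n0); lra.
apply: enorm_le => // i; rewrite !mxE ler_norml.
by have /andP[? ?] := xy i; have /andP[? ?] := xz i; lra.
Qed.

Lemma lebesgue_outer0_cover B (e : R) : 0 < e -> lebesgue_outer B = 0%E ->
  exists (U : (set 'rV[R]_n)^nat) (r : nat -> R),
    [/\ B `<=` \bigcup_k U k, forall k, 0 <= r k,
        forall k x y, U k x -> U k y -> enorm (x - y) <= n%:R * r k &
        (\sum_(k <oo) (r k ^+ n)%:E <= e%:E)%E].
Proof.
move=> e0 B0; have e20 : 0 < e / 2 by rewrite divr_gt0.
have /ereal_inf_lt[_ [U BU <-] Ue] : (lebesgue_outer B < (e / 2)%:E)%E.
  by rewrite B0 lte_fin.
(* [cube_volume] is an infimum, so a side is chosen up to an error; half of [e] pays for the cover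
   and half for these errors. *)
have /choice[r rP] : forall k, exists r : R, [/\ 0 <= r,
    forall x y, U k x -> U k y -> enorm (x - y) <= n%:R * r &
    ((r ^+ n)%:E <= cube_volume (U k) + (e / 2 / (2 ^ k.+1)%:R)%:E)%E].
  move=> k; have ek0 : 0 < e / 2 / (2 ^ k.+1)%:R.
    by rewrite divr_gt0// ltr0n expn_gt0.
  have [U0|U0] := eqVneq (U k) set0.
    exists 0; rewrite U0; split => //.
    by rewrite cube_volume0 add0e lee_fin expr0n gtn_eqF// ltW.
  have : (cube_volume (U k) <
          cube_volume (U k) + (e / 2 / (2 ^ k.+1)%:R)%:E)%E.
    rewrite lteDl ?lte_fin// ge0_fin_numE ?cube_volume_ge0//.
    apply: le_lt_trans (lt_trans Ue (ltry _)).
    apply: le_trans (nneseries_lim_ge k.+1 _); last first.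
      by move=> *; exact: cube_volume_ge0.
    rewrite big_nat_recr//= leeDr// sume_ge0// => *; exact: cube_volume_ge0.
  rewrite {1}/cube_volume (negbTE U0) => /ereal_inf_lt[_ [r [r0 [x ->]] <-] rU].
  exists r; split => //; last exact: ltW.
  by move=> y z; exact: enorm_cube.
exists U, r; split => //; try by move=> k; have [] := rP k.
apply: (@le_trans _ _ (\sum_(k <oo)
    (cube_volume (U k) + (e / 2 / (2 ^ k.+1)%:R)%:E))%E).
  apply: lee_nneseries => k; last by have [] := rP k.
  by move=> _ _; rewrite lee_fin exprn_ge0//; have [] := rP k.
apply: le_trans (epsilon_trick _ _ (ltW e20)) _.
  by move=> k; exact: cube_volume_ge0.
by rewrite [in leRHS](splitr e) EFinD leeD2r// ltW.
Qed.

Variables (theta : 'rV[R]_n -> R) (Omega : set 'rV[R]_n) (L : R).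
Hypothesis L0 : 0 <= L.
Hypothesis thetaL : forall x y, Omega x -> Omega y ->
  `|theta x - theta y| <= L * enorm (x - y).

Lemma null_slices A : A `<=` Omega -> (lebesgueRn R n).-negligible A ->
  {ae lebesgue_measure, forall t : R,
     hausdorff_outer n.-1 (A `&` theta @^-1` [set t]) = 0%E}.
Proof.
move=> AO [B [mB B0 AB]].
have nR0 : 0 < n%:R :> R by rewrite ltr0n.
have [||delta d0|F [mF F0 Fi HF]] := @eilenberg R n theta A L n0 L0 _ 0.
- by move=> x y /AO ? /AO ?; exact: thetaL.
- by [].
(* After scaling by [n], the bound [delta] controls the sum, while [delta ^ n] forces every single
   [n * r k] to be at most [delta]. *)
- pose e := Num.min delta (delta ^+ n) / n%:R ^+ n.
  have e0 : 0 < e by rewrite divr_gt0// ?lt_min ?d0 ?exprn_gt0.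
  have [U [r [BU r0 Ur re]]] := lebesgue_outer0_cover e0 B0.
  have nre : (\sum_(k <oo) ((n%:R * r k) ^+ n)%:E <=
              (Num.min delta (delta ^+ n))%:E)%E.
    under eq_eseriesr do rewrite exprMn EFinM.
    rewrite nneseriesZl; last by move=> k _; rewrite lee_fin exprn_ge0.
    apply: le_trans (lee_wpmul2l _ re) _; first by rewrite lee_fin exprn_ge0.
    by rewrite -EFinM lee_fin /e mulrC divfK// gt_eqF ?exprn_gt0.
  have nr0 k : 0 <= n%:R * r k by rewrite mulr_ge0.
  exists U, (fun k => n%:R * r k); split.
  + move=> k; rewrite nr0/= -(ler_pXn2r n0) ?nnegrE ?(ltW d0)//.
    rewrite -lee_fin.
    apply: (@le_trans _ _ (Num.min delta (delta ^+ n))%:E).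
      apply: le_trans nre; apply: le_trans (nneseries_lim_ge k.+1 _).
        rewrite big_nat_recr//= leeDr// sume_ge0// => *.
        by rewrite lee_fin exprn_ge0.
      by move=> *; rewrite lee_fin exprn_ge0.
    by rewrite lee_fin ge_min lexx orbT.
  + exact: subset_trans AB BU.
  + exact: Ur.
  + by apply: le_trans nre _; rewrite lee_fin add0r ge_min lexx.
- have : ae_eq lebesgue_measure setT F (cst 0%E).
    apply/ae_eq_integral_abs => //; apply/eqP; rewrite eq_le.
    rewrite integral_ge0// andbT; under eq_integral do rewrite gee0_abs//.
    by rewrite mulr0 in Fi.
  apply: filterS => t /(_ Logic.I) /= Ft; apply/eqP.
  by rewrite eq_le outer_measure_ge0 andbT -Ft HF.
Qed.

Lemma finite_slices : bounded_set Omega ->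
  {ae lebesgue_measure, forall t : R,
     (hausdorff_outer n.-1 (Omega `&` theta @^-1` [set t]) < +oo)%E}.
Proof.
case=> M [_ OM]; pose B := Num.max 1 (M + 2).
have B0 : 0 < B by rewrite lt_max ltr01.
have OB x i : Omega x -> - B < x 0 i < B.
  move=> Ox; rewrite -ltr_norml.
  apply: (@le_lt_trans _ _ (M + 1)); last first.
    by rewrite lt_max; apply/orP; right; lra.
  apply: le_trans (OM (M + 1) _ x Ox); last by rewrite ltrDl.
  rewrite [leRHS]mx_normrE.
  by apply: (le_bigmax _ (fun ij => `|x ij.1 ij.2|) (0, i)).
have nR0 : 0 < n%:R :> R by rewrite ltr0n.
have [|delta d0|F [mF F0 Fi HF]] :=
    @eilenberg R n theta Omega L n0 L0 thetaL ((n%:R * (2 * B)) ^+ n).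
- by rewrite exprn_ge0// mulr_ge0// ltW// mulr_gt0.
(* A grid of N^n cubes of side [r] covers [Omega], with [N] so large that [n * r <= delta]. Its sum
   of [(n * r) ^ n] is [(n * (2 * B)) ^ n] whatever [N] is, so the bound is uniform in [delta].
   Indices beyond the grid get the empty set and diameter 0. *)
- pose N := (Num.truncn (n%:R * (2 * B) / delta)).+1.
  have N0 : 0 < N%:R :> R by rewrite ltr0n.
  have nBd : 0 <= n%:R * (2 * B) / delta.
    by rewrite divr_ge0 ?(ltW d0)// !mulr_ge0 ?ltW.
  pose r := 2 * B / N%:R; have r0 : 0 < r by rewrite divr_gt0// mulr_gt0.
  have rd : n%:R * r <= delta.
    rewrite /r mulrA ler_pdivrMr// [leRHS]mulrC -ler_pdivrMr// ltW//.
    by have /andP[] := truncn_itv nBd.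
  pose T := {ffun 'I_n -> 'I_N}.
  pose corner (f : T) : 'rV[R]_n := \row_i (- B + r * (f i)%:R).
  pose U k := if insub k : option 'I_#|T| is Some j
              then cube (corner (enum_val j)) r else set0.
  pose d k := if (k < #|T|)%N then n%:R * r else 0.
  exists U, d; split.
  + move=> k; rewrite /d; case: ifP; rewrite ?lexx ?(ltW d0)//.
    by rewrite rd mulr_ge0 ?ltW.
  + move=> x Ox.
    have xi0 i : 0 <= (x 0 i + B) / r.
      by rewrite divr_ge0 ?(ltW r0)//; have /andP[? ?] := OB x i Ox; lra.
    have xiN i : (Num.truncn ((x 0 i + B) / r)%R < N)%N.
      rewrite truncn_lt_nat// ltr_pdivrMr// /r mulrC divfK ?gt_eqF//.
      by have /andP[? ?] := OB x i Ox; lra.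
    pose f : T := [ffun i => Ordinal (xiN i)].
    exists (enum_rank f : nat) => //; rewrite /U valK enum_rankK => i.
    rewrite !mxE ffunE/=; have /andP[] := truncn_itv (xi0 i).
    rewrite ler_pdivlMr// ltr_pdivrMr//.
    by set m := Num.truncn _; rewrite -[m.+1%:R]natr1 mulrDl mul1r mulrC; lra.
  + move=> k x y; rewrite /U /d; case: insubP => [j -> _|//].
    exact: enorm_cube.
  + rewrite (nneseries_split 0 #|T|); last first.
      move=> k _; rewrite lee_fin exprn_ge0// /d; case: ifP => // _.
      by rewrite mulr_ge0// ltW.
    rewrite add0n [X in (_ + X)%E]eseries0; last first.
      by move=> k Tk _; rewrite /d ltnNge Tk/= expr0n gtn_eqF.
    rewrite adde0 big_mkord (eq_bigr (fun=> ((n%:R * r) ^+ n)%:E)); last first.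
      by move=> k _; rewrite /d ltn_ord.
    rewrite sumEFin sumr_const card_ord card_ffun !card_ord lee_fin.
    rewrite -[leLHS]mulr_natr natrX -exprMn -mulrA divfK ?gt_eqF//.
    by rewrite lerDl ltW.
- have : lebesgue_measure.-integrable setT F.
    apply/integrableP; split => //.
    under eq_integral do rewrite gee0_abs//.
    exact: le_lt_trans Fi (ltry _).
  move/integrable_ae => /(_ measurableT); apply: filterS => t /(_ Logic.I) Ft.
  by apply: le_lt_trans (HF t) _; rewrite ltey_eq Ft.
Qed.

End slices.

(** * Measurability of the area of level sets *)

Section measurable_slices.
Local Open Scope ereal_scope.
Variables (R : realType) (n m : nat).
Implicit Types (U V K : set 'rV[R]_n) (delta : R).

(** The [r]-neighbourhood of [U] is open, and its diameter exceeds that of [U] by at most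
    [2 * (n * r)], with a factor [n] because balls are those of the sup norm. The result may pass
    [delta], hence the scale [2 * delta]; a small [r] costs at most [e] in the gauge by continuity
    of [phi]. *)
Lemma hausdorff_gauge_open U delta (e : R) : (0 < delta)%R -> (0 < e)%R ->
  hausdorff_gauge m delta U < +oo ->
  exists V, [/\ open V, U `<=` V &
    hausdorff_gauge m (2 * delta) V <= hausdorff_gauge m delta U + e%:E].
Proof.
move=> delta0 e0; have [->|U0 gUoo] := eqVneq U set0.
  move=> _; exists set0; split => //.
  by rewrite !hausdorff_gauge0 add0e lee_fin ltW.
have [Ud gUE] : diam U <= delta%:E /\ hausdorff_gauge m delta U =
    (unit_ball_volume R m)%:E * (diam U * (2^-1)%:E) ^+ m.
  by move: gUoo; rewrite /hausdorff_gauge (negbTE U0); case: ifPn.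
have /set0P/diam_ge0 dU0 := U0.
have [d dE] : exists d : R, diam U = d%:E.
  exists (fine (diam U)).
  by rewrite fineK// ge0_fin_numE// (le_lt_trans Ud)// ltry.
move: dU0 Ud gUE; rewrite dE !lee_fin => d0 ddelta ->.
pose phi (r : R) := (unit_ball_volume R m * ((d + 2 * (n%:R * r)) / 2) ^+ m)%R.
have phi_cont : phi r @[r --> 0%R] --> phi 0%R.
  apply: cvgMr; apply: (@cvg_comp _ _ _ _ (fun r : R => r ^+ m)%R); last first.
    exact: exprn_continuous.
  apply: cvgMl; apply: cvgD; first exact: cvg_cst.
  by apply: cvgMr; apply: cvgMr; exact: cvg_id.
have /cvgrPdist_le/(_ _ e0) phi_ball := phi_cont.
have [r r0 [rphi rdelta]] : exists2 r : R, (0 < r)%R &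
    (phi r <= phi 0 + e)%R /\ (2 * (n%:R * r) <= delta)%R.
  have [s /= s0 sP] := phi_ball.
  pose r := Num.min (s / 2)%R (delta / (2 * n.+1%:R))%R.
  have nd0 : (0 < 2 * n.+1%:R :> R)%R by rewrite mulr_gt0.
  have r0 : (0 < r)%R by rewrite lt_min !divr_gt0.
  exists r => //; split.
    have /sP : ball_ Num.norm 0%R s r.
      rewrite /ball_/= sub0r normrN gtr0_norm//.
      by rewrite gt_min ltr_pdivrMr// ltr_pMr// ltr1n.
    by rewrite /= distrC => /ler_normlW; rewrite lerBlDl.
  have : (r <= delta / (2 * n.+1%:R))%R by rewrite ge_min lexx orbT.
  rewrite ler_pdivlMr// mulrCA [(r * _)%R]mulrC; apply: le_trans.
  by rewrite ler_wpM2l// ler_wpM2r ?(ltW r0)// ler_nat.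
pose V := \bigcup_(x in U) ball x r.
have UV : U `<=` V by move=> x Ux; exists x => //; exact: ballxx.
exists V; split => //; first by apply: bigcup_open => x _; exact: ball_open.
apply: le_trans (_ : (phi r)%:E <= _).
  apply: hausdorff_gauge_ub.
    rewrite addr_ge0 ?mulr_ge0 ?(ltW r0)//=; lra.
  move=> x y [x' Ux' xx'] [y' Uy' yy'].
  have nr (z z' : 'rV[R]_n) : ball z r z' -> (enorm (z - z') <= n%:R * r)%R.
    rewrite -ball_normE/= => /ltW zz'.
    by apply: le_trans (enorm_le_norm _) _; exact: ler_wpM2l.
  have -> : (x - y = (x' - y') + ((y' - y) - (x' - x)))%R.
    by apply/rowP => i; rewrite !mxE; ring.
  apply: le_trans (ler_enormD _ _) _; apply: lerD.
    by have := ge_diam Ux' Uy'; rewrite dE lee_fin.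
  apply: le_trans (ler_enormD _ _) _; rewrite enormN mulr_natl mulr2n.
  by apply: lerD; exact: nr.
apply: (@le_trans _ _ (phi 0%R + e)%:E); first by rewrite lee_fin.
by rewrite EFinD leeD2r// /phi mulr0 mulr0 addr0 EFinM EFin_expe EFinM.
Qed.

(** Thicken a cover of the slice at [t] to an open set [W]. The part of [K] outside [W] is compact
    and its image under [theta] is a closed set missing [t]; for [s] off this image the same cover
    contains the slice at [s]. *)
Lemma slice_usc K (theta : 'rV[R]_n -> R) delta (c t : R) :
  compact K -> {within K, continuous theta} -> (0 < delta)%R ->
  cover_outer (hausdorff_gauge m delta) (K `&` theta @^-1` [set t]) < c%:E ->
  \forall s \near t,
    cover_outer (hausdorff_gauge m (2 * delta)) (K `&` theta @^-1` [set s])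
      <= c%:E.
Proof.
move=> cK ctheta delta0 /ereal_inf_lt[_ [U KU <-] Uc].
have U0 k : 0 <= hausdorff_gauge m delta (U k) by exact: hausdorff_gauge_ge0.
set y := \sum_(k <oo) _ in Uc.
have yfin : y \is a fin_num.
  by rewrite ge0_fin_numE ?nneseries_ge0// (lt_trans Uc)// ltry.
pose e := (c - fine y)%R.
have e0 : (0 < e)%R by rewrite subr_gt0 -lte_fin fineK.
have /choice[V VP] : forall k, exists V, [/\ open V, U k `<=` V &
    hausdorff_gauge m (2 * delta) V <=
      hausdorff_gauge m delta (U k) + (e / (2 ^ k.+1)%:R)%:E].
  move=> k; apply: hausdorff_gauge_open => //.
    by rewrite divr_gt0// ltr0n expn_gt0.
  apply: le_lt_trans (lt_trans Uc (ltry _)).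
  apply: le_trans (nneseries_lim_ge k.+1 _) => //.
  by rewrite big_nat_recr//= leeDr// sume_ge0.
pose W := \bigcup_k V k.
have oW : open W by apply: bigcup_open => k _; have [] := VP k.
have cKW : compact (K `&` ~` W).
  by apply: compact_closedI => //; exact: open_closedC.
have cT : closed (theta @` (K `&` ~` W)).
  apply: compact_closed; first exact: Rhausdorff.
  apply: continuous_compact cKW.
  by apply: continuous_subspaceW ctheta => x [].
have : nbhs t (~` (theta @` (K `&` ~` W))).
  apply: open_nbhs_nbhs; split; first exact: closed_openC.
  move=> [x [Kx Wx] tx]; apply: Wx.
  have [k _ Ukx] := KU x (conj Kx tx).
  by exists k => //; have [_ UV _] := VP k; exact: UV.
apply: filterS => s sP.
apply: (@le_trans _ _ (\sum_(k <oo) hausdorff_gauge m (2 * delta) (V k))).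
  apply: ereal_inf_lbound; exists V => // x [Kx sx].
  by apply: contrapT => Wx; apply: sP; exists x.
apply: (@le_trans _ _ (\sum_(k <oo)
    (hausdorff_gauge m delta (U k) + (e / (2 ^ k.+1)%:R)%:E))).
  apply: lee_nneseries => k; first by move=> _ _; exact: hausdorff_gauge_ge0.
  by have [] := VP k.
apply: le_trans (epsilon_trick _ U0 (ltW e0)) _.
by rewrite -/y -(fineK yfin) -EFinD lee_fin /e addrC subrK.
Qed.

Lemma compact_slices_measurable K (theta : 'rV[R]_n -> R) :
  compact K -> {within K, continuous theta} ->
  measurable_fun setT
    (fun t : R => hausdorff_outer m (K `&` theta @^-1` [set t])).
Proof.
move=> cK ctheta; pose H t := hausdorff_outer m (K `&` theta @^-1` [set t]).
pose h delta t :=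
  cover_outer (hausdorff_gauge m delta) (K `&` theta @^-1` [set t]).
have hH delta t : (0 < delta)%R -> h delta t <= H t.
  by move=> d0; apply: ereal_sup_ubound; exists delta.
apply: (measurability _ (ErealGenOInfty.measurableE R)) => //.
move=> _ [_ [c ->] <-]; rewrite setTI.
have i0 i : (0 < i.+1%:R^-1 :> R)%R by rewrite invr_gt0.
(* [H t <= c] is equivalent to membership in these countably many interiors: semicontinuity gives
   one direction, with the doubled scale, and letting [i] and [j] tend to infinity gives the other.
   Interiors are open, so measurability of [h] itself never arises. *)
rewrite (_ : _ @^-1` _ = ~` (\bigcap_i \bigcap_j
    [set s | h (2 * i.+1%:R^-1)%R s <= (c + j.+1%:R^-1)%:E]°)).
  apply: measurableC; apply: bigcapT_measurable => i.
  apply: bigcapT_measurable => j; apply: open_measurable; exact: open_interior.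
apply/seteqP; split => [t /=|t /= tP].
  rewrite in_itv/= andbT => cH tP; move: cH; apply/negP; rewrite -leNgt.
  apply: ge_ereal_sup => _ [delta /= delta0 <-].
  have d20 : (0 < delta / 2)%R by rewrite divr_gt0.
  have [i _ /(_ i (leqnn i))/= id] := near_infty_natSinv_lt (PosNum d20).
  apply/lee_addgt0Pr => e e0.
  have [j _ /(_ j (leqnn j))/= je] := near_infty_natSinv_lt (PosNum e0).
  apply: (@le_trans _ _ (h (2 * i.+1%:R^-1)%R t)).
    by apply: cover_outer_delta; rewrite mulrC -ler_pdivlMr// ltW.
  apply: le_trans (interior_subset (tP i Logic.I j Logic.I)) _.
  by rewrite -EFinD lee_fin lerD2l ltW.
rewrite in_itv/= andbT ltNge; apply/negP => Hc; apply: tP => i _ j _.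
apply: slice_usc => //; apply: le_lt_trans (hH _ _ (i0 i)) _.
by apply: le_lt_trans Hc _; rewrite lte_fin ltrDl.
Qed.

End measurable_slices.

Section level_set.
Variables (R : realType) (n : nat) (theta : 'rV[R]_n -> R).
Variables (Omega : set 'rV[R]_n) (L : R).
Hypothesis Omega_open : open Omega.
Hypothesis L0 : 0 <= L.
Hypothesis thetaL : forall x y, Omega x -> Omega y ->
  `|theta x - theta y| <= L * enorm (x - y).

Let K := L * n%:R + 1.
Let K_gt0 : 0 < K.
Proof. by rewrite ltr_wpDl// mulr_ge0. Qed.

Lemma lipschitz_ball x y e : 0 < e -> Omega x -> Omega y -> ball x (e / K) y ->
  `|theta x - theta y| < e.
Proof.
move=> e0 Ox Oy; rewrite -ball_normE/= ltr_pdivlMr// => xy.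
apply: le_lt_trans (thetaL Ox Oy) _; apply: le_lt_trans xy.
apply: le_trans (ler_wpM2l L0 (enorm_le_norm _)) _.
by rewrite mulrA mulrC ler_wpM2l// lerDl.
Qed.

Lemma lipschitz_within_continuous (A : set 'rV[R]_n) : A `<=` Omega ->
  {within A, continuous theta}.
Proof.
move=> AO; apply/subspace_continuousP => x Ax; apply/cvgrPdist_lt => e e0.
have eK0 : 0 < e / K by rewrite divr_gt0.
apply/nbhs_ballP; exists (e / K) => //= y xy Ay.
exact: lipschitz_ball (AO _ Ax) (AO _ Ay) xy.
Qed.

(** The Lipschitz bound is available on [Omega] only, so the level set is closed relative to
    [Omega]: it is the trace on an open set of its own closure. *)
Lemma level_set_measurable m t :
  (@hausdorff_outer R n m).-caratheodory (level_set Omega theta t).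
Proof.
rewrite (_ : level_set _ _ _ = Omega `&` closure (level_set Omega theta t)).
  apply: caratheodory_measurable_setI; first exact: open_hausdorff_measurable.
  apply: closed_hausdorff_measurable; exact: closed_closure.
apply/seteqP; split => [x [Ox tx]|x [Ox cx]].
  by split => //; apply: subset_closure.
split => //; apply/eqP; rewrite -subr_eq0 -normr_eq0 eq_le normr_ge0 andbT.
apply/ler_addgt0Pr => e e0; rewrite add0r ltW//.
have eK0 : 0 < e / K by rewrite divr_gt0.
have [y [[Oy <-] xy]] := cx _ (nbhsx_ballx x _ eK0).
exact: lipschitz_ball.
Qed.

(** [Omega] is exhausted by the compact sets [C j] of points at distance at least 1/(j+1) from its
    complement; continuity of the measure from below then gives the area as a pointwise limit of
    measurable functions of [t]. *)
Lemma level_area_measurable : bounded_set Omega ->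
  measurable_fun setT (level_area Omega theta).
Proof.
move=> bO.
pose C j := [set x : 'rV[R]_n | forall y, ~ Omega y -> j.+1%:R^-1 <= `|x - y|].
have CO j : C j `<=` Omega.
  move=> x Cx; apply: contrapT => /Cx; rewrite subrr normr0 leNgt.
  by rewrite invr_gt0 ltr0n.
have clC j : closed (C j).
  move=> x cx y Oy; rewrite leNgt; apply/negP => xy.
  have r0 : 0 < j.+1%:R^-1 - `|x - y| by rewrite subr_gt0.
  have [z [Cz]] := cx _ (nbhsx_ballx x _ r0).
  rewrite -ball_normE/= ltrBrDr => xz.
  have := le_trans (Cz y Oy) (ler_distD x z y).
  by rewrite leNgt distrC xz.
have cC j : compact (C j).
  apply: bounded_closed_compact (clC j).
  have [M [Mreal OM]] := bO.
  by exists M; split => // y My x /CO; exact: OM.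
have CS i j : (i <= j)%N -> C i `<=` C j.
  move=> ij x Cx y /Cx; apply: le_trans.
  by rewrite lef_pV2 ?posrE// ler_nat.
have OC : Omega = \bigcup_j C j.
  apply/seteqP; split => [x Ox|x [j _ /CO]//].
  have /nbhs_ballP[e /= e0 xeO] : nbhs x Omega by exact: open_nbhs_nbhs.
  have [j _ /(_ j (leqnn j))/= je] := near_infty_natSinv_lt (PosNum e0).
  exists j => // y Oy; rewrite leNgt; apply/negP => xy; apply: Oy.
  by apply: xeO; rewrite -ball_normE/= (lt_trans xy).
apply: (@emeasurable_fun_cvg _ _ _ _
    (fun j t => hausdorff_outer n.-1 (C j `&` theta @^-1` [set t]))).
  move=> j; apply: compact_slices_measurable => //.
  exact: lipschitz_within_continuous.
move=> t _; pose F j := C j `&` level_set Omega theta t.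
have FE j : C j `&` theta @^-1` [set t] = F j.
  apply/seteqP; split => [x [Cx tx]|x [Cx [_ tx]]]; split => //.
  by split => //; exact: CO Cx.
under eq_fun do rewrite FE.
have -> : level_area Omega theta t = hausdorff R n n.-1 (\bigcup_j F j).
  rewrite -setI_bigcupl -OC /level_area; congr (hausdorff R n n.-1 _).
  by apply/seteqP; split => [x []|x [_ []]].
apply: (@nondecreasing_cvg_mu _ _ _ (hausdorff R n n.-1)).
- move=> j; apply: caratheodory_measurable_setI; last first.
    exact: level_set_measurable.
  exact: closed_hausdorff_measurable.
- apply: bigcupT_measurable => j.
  apply: caratheodory_measurable_setI; last exact: level_set_measurable.
  exact: closed_hausdorff_measurable.
- by move=> i j ij; apply/subsetPset => x [Cx tx]; split => //; exact: CS Cx.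
Qed.

End level_set.

(** * Borel representatives of Lebesgue measurable functions *)

Section lebesgue_borel.
Variable R : realType.

Lemma lebesgue_measurable_borel (A : set (lebesgue_type R)) : measurable A ->
  exists2 B : set R, measurable B &
    lebesgue_measure.-negligible ((A `\` B) `|` (B `\` A)).
Proof.
rewrite -completed_caratheodory_measurable g_sigma_completed_algebra_genE.
case=> B mB [N negN] <-; exists B => //; apply: negligibleS negN.
by move=> x [[[]]|[? []]]//; left.
Qed.

(** A real number is the infimum of the rationals above it, so [f] is determined by countably many
    sublevel sets. Each agrees with a Borel set [B i] up to a null set, and the same infimum taken
    over the [B i] gives [g], which equals [f] on [D] off the union of these null sets. *)
Lemma lebesgue_measurable_fun_borel (D : set R) (f : R -> R) :
  measurable D -> measurable_fun (D : set (lebesgue_type R)) f ->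
  exists2 g : R -> R, measurable_fun setT g &
    {ae lebesgue_measure, forall x, D x -> f x = g x}.
Proof.
(* [q] enumerates the rationals; a natural that encodes none gives 0, which only repeats an
   entry. *)
move=> mD mf; pose q (i : nat) : R := ratr (odflt 0 (unpickle i)).
have mD' : measurable (D : set (lebesgue_type R)) by exact: sub_caratheodory.
have /choice[B BP] : forall i, exists B : set R, measurable B /\
    let A := D `&` f @^-1` `]-oo, q i[%classic in
    lebesgue_measure.-negligible ((A `\` B) `|` (B `\` A)).
  move=> i; have /lebesgue_measurable_borel[B mB negB] :
      measurable ((D : set (lebesgue_type R)) `&` f @^-1` `]-oo, q i[%classic).
    by apply: mf => //; exact: measurable_itv.
  by exists B.
pose h (i : nat) (x : R) : \bar R := if x \in B i then (q i)%:E else +oo%E.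
pose g x := fine (einfs (h ^~ x) 0).
exists g.
  apply: measurableT_comp => //; apply: measurable_fun_einfs => i.
  apply: measurable_fun_if => //.
    apply: (measurable_fun_bool true); rewrite setTI.
    rewrite (_ : _ @^-1` _ = B i); first by have [] := BP i.
    by apply/seteqP; split => x /=; [move/set_mem|move/mem_set].
have : lebesgue_measure.-negligible (\bigcup_i
    let A := D `&` f @^-1` `]-oo, q i[%classic in (A `\` B i) `|` (B i `\` A)).
  by apply: negligible_bigcup => i; have [] := BP i.
apply: negligibleS => x; apply: contra_notP => xN Dx.
have hE i : h i x = if f x < q i then (q i)%:E else +oo%E.
  rewrite /h; case: ifPn => [/set_mem Bx|/negP Bx]; case: ifPn => // fq.
    exfalso; apply: xN; exists i => //; right; split => // -[_].
    by rewrite /= in_itv/= (negbTE fq).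
  exfalso; apply: xN; exists i => //; left; split.
    by split => //; rewrite /= in_itv.
  by move/mem_set.
suff -> : g x = f x by [].
rewrite /g; suff -> : einfs (h ^~ x) 0 = (f x)%:E by [].
apply/eqP; rewrite eq_le; apply/andP; split; last first.
  apply: le_ereal_inf_tmp => _ [i _ <-]; rewrite hE.
  by case: ifPn => [/ltW|_]; rewrite ?lee_fin ?leey.
apply/lee_addgt0Pr => e e0; have [r] := rat_in_itvoo (ltr_pwDr e0 (lexx (f x))).
rewrite in_itv/= => /andP[fr re].
apply: (@le_trans _ _ (ratr r)%:E); last first.
  by rewrite -EFinD lee_fin ltW.
apply: ereal_inf_lbound; exists (pickle r) => //.
by rewrite hE /q pickleK/= fr.
Qed.

End lebesgue_borel.

(** * Sobolev functions on an interval *)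

(** For a truncated square, the quadratic error bound is a polynomial inequality on each sign
    pattern. *)
Lemma quadratic_is_derive (R : realType) (f : R -> R) (x l : R) :
  (forall y, `|f y - f x - l * (y - x)| <= (y - x) ^+ 2) -> is_derive x 1 f l.
Proof.
move=> fq.
have cf : h^-1 *: (f (h *: (1 : R) + x) - f x) @[h --> 0^'] --> l.
  apply/cvgrPdist_le => e e0; exists e => //= h.
  rewrite /ball_/= sub0r normrN => /ltW he h0.
  have -> : h *: (1 : R) = h by rewrite /GRing.scale/= mulr1.
  have := fq (h + x); rewrite addrK => fh.
  have -> : l - h^-1 *: (f (h + x) - f x) = - h^-1 * (f (h + x) - f x - l * h).
    by rewrite /GRing.scale/=; field.
  rewrite normrM normrN normfV ler_pdivrMl ?normr_gt0//.
  apply: (le_trans fh); rewrite -[h ^+ 2]real_normK ?num_real// expr2.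
  by rewrite ler_wpM2l.
apply: DeriveDef; first by apply/cvg_ex; exists l.
exact: cvg_lim cf.
Qed.

Section ramp.
Variables (R : realType) (h : R).

(* The C^1 quadratic spline rising from 0 to 1 on [0, 2h]. *)
Definition ramp (x : R) : R :=
  (Num.max x 0 ^+ 2 - 2 * Num.max (x - h) 0 ^+ 2 +
   Num.max (x - 2 * h) 0 ^+ 2) / (2 * h ^+ 2).

(** The derivative of [ramp]: the hat function on [0, 2h] with peak 1/h and integral 1. *)
Definition tent (x : R) : R :=
  (Num.max x 0 - 2 * Num.max (x - h) 0 + Num.max (x - 2 * h) 0) / h ^+ 2.

Lemma ramp0 (x : R) : 0 < h -> x <= 0 -> ramp x = 0.
Proof.
move=> h0.
move=> x0; have [xh x2h] : x - h <= 0 /\ x - 2 * h <= 0 by split; lra.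
by rewrite /ramp !max_r// expr0n/= mulr0 subrr addr0 mul0r.
Qed.

Lemma ramp1 (x : R) : 0 < h -> 2 * h <= x -> ramp x = 1.
Proof.
move=> h0.
move=> hx; have [x0 xh x2h] : [/\ 0 <= x, 0 <= x - h & 0 <= x - 2 * h].
  by split; lra.
by rewrite /ramp !max_l//; field; rewrite gt_eqF.
Qed.

Lemma ramp_itv (x : R) : 0 < h -> 0 <= ramp x <= 1.
Proof.
move=> h0.
have hh : 0 < 2 * h ^+ 2 by rewrite mulr_gt0// exprn_gt0.
have [x0|x0] := leP x 0; first by rewrite ramp0// lexx ler01.
have [hx|hx] := leP (2 * h) x; first by rewrite ramp1// lexx ler01.
have x2h : x - 2 * h <= 0 by lra.
rewrite /ramp (max_r x2h) (max_l (ltW x0)) expr0n addr0 ler_pdivrMr// mul1r.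
have [xh|xh] := leP (x - h) 0; rewrite ?expr0n ?mulr0 ?subr0.
  apply/andP; split; last by nra.
  by rewrite divr_ge0 ?sqr_ge0 ?(ltW hh).
apply/andP; split; last by nra.
rewrite divr_ge0 ?(ltW hh)//.
have : 0 <= (x - h) * (2 * h - x) by apply: mulr_ge0; lra.
nra.
Qed.

Lemma tent_ge0 (x : R) : 0 < h -> 0 <= tent x.
Proof.
move=> h0; rewrite divr_ge0 ?sqr_ge0//.
by case: (leP x 0) (leP (x - h) 0) (leP (x - 2 * h) 0) => ? [] ? [] ?; lra.
Qed.

Lemma tent0 (x : R) : 0 < h -> ~~ (0 <= x <= 2 * h) -> tent x = 0.
Proof.
move=> h0.
rewrite negb_and -!ltNge => /orP[x0|hx].
  have [xh x2h] : x - h <= 0 /\ x - 2 * h <= 0 by split; lra.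
  by rewrite /tent !max_r ?(ltW x0)// mulr0 subrr addr0 mul0r.
have [x0 xh x2h] : [/\ 0 <= x, 0 <= x - h & 0 <= x - 2 * h] by split; lra.
by rewrite /tent !max_l//; field; rewrite gt_eqF.
Qed.

Lemma tent_continuous : continuous tent.
Proof.
have cm (c x : R) : Num.max (y - c) 0 @[y --> x] --> Num.max (x - c) 0.
  apply: (@continuous_max _ _ (fun y : R => y - c) (cst 0)); last first.
    exact: cst_continuous.
  by apply: cvgB; [exact: cvg_id|exact: cvg_cst].
move=> x; apply: cvgMl; apply: cvgD; last exact: cm.
apply: cvgB; last by apply: cvgMr; exact: cm.
by have := cm 0 x; under eq_fun do rewrite subr0; rewrite subr0.
Qed.

Lemma is_derive_ramp (c x : R) : 0 < h ->
  is_derive x 1 (fun y => ramp (y - c)) (tent (x - c)).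
Proof.
move=> h0; have dm (d : R) : is_derive x 1 (fun y => Num.max (y - d) 0 ^+ 2)
    (2 * Num.max (x - d) 0).
  apply: quadratic_is_derive => y; rewrite ler_norml.
  have sq := sqr_ge0 (y - d); have sq' := sqr_ge0 (y - x).
  have [xd|xd] := leP (x - d) 0; have [yd|yd] := leP (y - d) 0.
  - by rewrite expr0n/=; lra.
  - have : 0 <= (d - x) * (y - d) by apply: mulr_ge0; lra.
    have := sqr_ge0 (d - x); rewrite expr0n/= => ? ?; apply/andP; split; nra.
  - have : 0 <= (x - d) * (d - y) by apply: mulr_ge0; lra.
    have := sqr_ge0 (x - d); rewrite expr0n/= => ? ?; apply/andP; split; nra.
  - by apply/andP; split; nra.
pose k := (2 * h ^+ 2)^-1.
rewrite (_ : (fun y => _) = k \*: ((fun y => Num.max (y - c) 0 ^+ 2) -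
  2 \*: (fun y => Num.max (y - (c + h)) 0 ^+ 2) +
  (fun y => Num.max (y - (c + 2 * h)) 0 ^+ 2))); last first.
  apply/funext => y; rewrite /ramp !fctE /GRing.scale/=.
  by rewrite mulrC !opprD !addrA.
apply: is_derive_eq; rewrite /tent /GRing.scale/=.
rewrite !opprD !addrA /k; set u := Num.max _ _; set v := Num.max _ _.
set w := Num.max _ _.
by field; rewrite gt_eqF.
Qed.

End ramp.

Section weak_derivative.
Variable R : realType.
Notation mu := (@lebesgue_measure R).
Implicit Types (f F v g : R -> R) (a b : R).

Lemma continuous_integrable_oo f a b : continuous f ->
  mu.-integrable `]a, b[ (EFin \o f).
Proof.
move=> cf; apply: (@integrableS _ _ _ mu `[a, b]) => //.
  exact: subset_itv_oo_cc.
apply: continuous_compact_integrable; first exact: segment_compact.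
exact: continuous_subspaceT.
Qed.

Lemma Rintegral_derive f F a b : a < b -> continuous f ->
  (forall x : R, is_derive x 1 F (f x)) ->
  \int[mu]_(x in `]a, b[) f x = F b - F a.
Proof.
move=> ab cf dF.
have cF : continuous F.
  move=> x; apply: differentiable_continuous; apply/derivable1_diffP.
  by have [] := dF x.
rewrite /Rintegral -(integral_itv_bndoo true false); last first.
  by apply/measurable_EFinP/measurable_funTS; exact: continuous_measurable_fun.
rewrite (continuous_FTC2 (F := F) ab)//.
- exact: continuous_subspaceT.
- split.
  + by move=> x _; have [] := dF x.
  + by apply: cvg_at_right_filter; exact: cF.
  + by apply: cvg_at_left_filter; exact: cF.
- by move=> x _; rewrite derive1E; have [_ ->] := dF x.
Qed.

Lemma integrableM_continuous f g a b : continuous f ->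
  mu.-integrable `]a, b[ (EFin \o g) ->
  mu.-integrable `]a, b[ (EFin \o (fun x => g x * f x)).
Proof.
move=> cf ig.
have -> : EFin \o (fun x => g x * f x) = ((EFin \o g) \* (EFin \o f))%E.
  by apply/funext => x /=; rewrite EFinM.
apply: integrableMl => //.
  by apply: measurable_funTS; exact: continuous_measurable_fun.
have [M [Mreal fM]] : bounded_set (f @` `[a, b]).
  apply: compact_bounded; apply: continuous_compact; last first.
    exact: segment_compact.
  exact: continuous_subspaceT.
exists M; split => // N MN x xab; apply: (fM N MN (f x)); exists x => //.
exact: subset_itv_oo_cc xab.
Qed.

Lemma tent_shift_continuous h c : continuous (fun x : R => tent h (x - c)).
Proof.
move=> x; apply: (@cvg_comp _ _ _ (fun y => y - c) (tent h) _ (nbhs (x - c))).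
  by apply: cvgB; [exact: cvg_id|exact: cvg_cst].
exact: tent_continuous.
Qed.

(** The primitive [ramp] rises from 0 to 1, so the shifted tent has mass one and the integral is an
    average of [v] over [c, c + 2h]. *)
Lemma tent_mean v a b (c h A e : R) : 0 < h -> a < c -> c + 2 * h < b ->
  mu.-integrable `]a, b[ (EFin \o v) ->
  (forall x, c <= x <= c + 2 * h -> `|v x - A| <= e) ->
  `|\int[mu]_(x in `]a, b[) (v x * tent h (x - c)) - A| <= e.
Proof.
move=> h0 ac chb iv vA; have ab : a < b by lra.
have ct := @tent_shift_continuous h c.
have it := continuous_integrable_oo a b ct.
have t1 : \int[mu]_(x in `]a, b[) tent h (x - c) = 1.
  rewrite (Rintegral_derive ab ct (fun x => is_derive_ramp c x h0)).
  by rewrite ramp1//; [rewrite ramp0// ?subr0//|]; lra.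
have iZt B : mu.-integrable `]a, b[ (EFin \o (fun x => B * tent h (x - c))).
  by apply: (integrableZl _ B it).
have iAt := iZt A.
have ivt := integrableM_continuous ct iv.
have -> : \int[mu]_(x in `]a, b[) (v x * tent h (x - c)) - A =
    \int[mu]_(x in `]a, b[) (v x * tent h (x - c) - A * tent h (x - c)).
  by rewrite RintegralB// RintegralZl// t1 mulr1.
have ivAt : mu.-integrable `]a, b[ (EFin \o
    (fun x => v x * tent h (x - c) - A * tent h (x - c))).
  by apply: (integrableB _ ivt iAt).
apply: le_trans (le_normr_Rintegral _ _) _ => //.
apply: (@le_trans _ _ (\int[mu]_(x in `]a, b[) (e * tent h (x - c))));
  last first.
  by rewrite RintegralZl// t1 mulr1.
apply: le_Rintegral => //; first exact: (integrable_abse ivAt).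
move=> x _; rewrite -mulrBl normrM (ger0_norm (tent_ge0 _ h0)).
have [xc|xc] := boolP (0 <= x - c <= 2 * h); last by rewrite tent0// !mulr0.
by rewrite ler_wpM2r ?tent_ge0// vA//; lra.
Qed.

Lemma abs_continuous_dist a b v : abs_continuous a b v ->
  forall e : R, 0 < e -> exists2 d : R, 0 < d &
    forall x y : R, a <= x -> x <= y -> y <= b ->
    y - x < d -> `|v y - v x| < e.
Proof.
move=> acv e /acv[d d0 dP]; exists d => // x y ax xy yb xyd.
have := dP 1 (fun=> x) (fun=> y); rewrite !big_ord1; apply => //.
by move=> i j _ _ _; rewrite !ord1.
Qed.

(** Test the weak derivative with plateaus [phi j] that tend to 1 on the open interval. On one side
    dominated convergence gives the integral of [g]; on the other the derivative is a difference of
    two tents, which average [v] near [a] and near [b] and so give [v a - v b]. *)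
Lemma sobolev11_FTC a b v g : a < b -> sobolev11 a b v g ->
  abs_continuous a b v -> \int[mu]_(x in `]a, b[) g x = v b - v a.
Proof.
move=> ab [iv ig wd] acv.
(* The ramps occupy [a + h, a + 3h] and [b - 3h, b - h]: the margins [h] keep the support compact in
   the open interval, and the factor 1/8 keeps the ramps apart. *)
pose h j : R := (b - a) / 8 * j.+1%:R^-1.
have b8 : 0 < (b - a) / 8 by rewrite divr_gt0 ?subr_gt0.
have h0 j : 0 < h j by rewrite mulr_gt0// invr_gt0.
have h8 j : h j <= (b - a) / 8.
  by rewrite -[leRHS]mulr1 ler_wpM2l ?(ltW b8)// invf_le1// ler1n.
pose phi j x := ramp (h j) (x - (a + h j)) - ramp (h j) (x - (b - 3 * h j)).
pose dphi j x := tent (h j) (x - (a + h j)) - tent (h j) (x - (b - 3 * h j)).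
have h_near (d : R) : 0 < d -> \forall j \near \oo, 3 * h j < d.
  have c0 : 0 < 3 * ((b - a) / 8) by rewrite mulr_gt0.
  move=> d0; have d0' : 0 < d / (3 * ((b - a) / 8)) by rewrite divr_gt0.
  have := near_infty_natSinv_lt (PosNum d0'); apply: filterS => j /=.
  by rewrite ltr_pdivlMr// => jd; rewrite /h mulrA mulrC.
have dphiP j (x : R) : is_derive x 1 (phi j) (dphi j x).
  by apply: is_deriveB; exact: is_derive_ramp.
have dphi_cont j : continuous (dphi j).
  by move=> x; apply: cvgB; exact: tent_shift_continuous.
have test j : test_function a b (phi j).
  split.
  - by move=> x; have [] := dphiP j x.
  - rewrite (_ : derive1 _ = dphi j)//; apply/funext => x.
    by rewrite derive1E; have [_ ->] := dphiP j x.
  - have hj := h0 j; have h8j := h8 j.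
    exists (a + h j), (b - h j); split; [lra|lra|] => x.
    rewrite in_itv/= negb_and -!ltNge /phi => /orP[xa|xb].
      by rewrite !ramp0 ?subrr//; lra.
    by rewrite !ramp1 ?subrr//; lra.
have phi_norm j (x : R) : `|phi j x| <= 1.
  have /andP[? ?] := ramp_itv (x - (a + h j)) (h0 j).
  have /andP[? ?] := ramp_itv (x - (b - 3 * h j)) (h0 j).
  by rewrite ler_norml /phi; apply/andP; split; lra.
have phi_cont j : continuous (phi j).
  move=> x; apply: differentiable_continuous; apply/derivable1_diffP.
  by have [] := dphiP j x.
have cvg_v : \int[mu]_(x in `]a, b[) (v x * dphi j x) @[j --> \oo] -->
    v a - v b.
  apply/cvgrPdist_le => e e0; have e20 : 0 < e / 2 by rewrite divr_gt0.
  have [d d0 dP] := abs_continuous_dist acv e20.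
  near=> j; have hd : 3 * h j < d by near: j; exact: h_near.
  have hj := h0 j; have h8j := h8 j.
  have va : `|\int[mu]_(x in `]a, b[) (v x * tent (h j) (x - (a + h j))) - v a|
      <= e / 2.
    apply: tent_mean => //; [lra|lra|] => x /andP[xa xh].
    by apply/ltW/dP => //; lra.
  have vb : `|\int[mu]_(x in `]a, b[)
      (v x * tent (h j) (x - (b - 3 * h j))) - v b|
      <= e / 2.
    apply: tent_mean => //; [lra|lra|] => x /andP[xa xh].
    by rewrite distrC; apply/ltW/dP => //; lra.
  have -> : \int[mu]_(x in `]a, b[) (v x * dphi j x) =
      \int[mu]_(x in `]a, b[) (v x * tent (h j) (x - (a + h j))) -
      \int[mu]_(x in `]a, b[) (v x * tent (h j) (x - (b - 3 * h j))).
    rewrite -RintegralB//;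
      try exact: integrableM_continuous (@tent_shift_continuous _ _) _.
    by apply: eq_Rintegral => x _; rewrite /dphi mulrBr.
  set A := Rintegral _ _ _ in va *; set B := Rintegral _ _ _ in vb *.
  rewrite (_ : _ - _ = (B - v b) - (A - v a)); last by ring.
  by apply: le_trans (ler_normB _ _) _; rewrite [leRHS](splitr e) lerD.
have cvg_g : \int[mu]_(x in `]a, b[) (g x * phi j x) @[j --> \oo] -->
    \int[mu]_(x in `]a, b[) g x.
  apply: fine_cvg; rewrite fineK; last exact: integrable_fin_num.
  have mg := measurable_int _ ig.
  have [] := @dominated_convergence _ _ _ mu `]a, b[ (measurable_itv _)
    (fun j x => (g x * phi j x)%:E) (EFin \o g) (abse \o (EFin \o g)).
  - by move=> j; exact: measurable_int (integrableM_continuous (phi_cont j) ig).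
  - exact: mg.
  - apply: aeW => x; rewrite /= in_itv/= => /andP[ax xb].
    apply: cvg_near_cst; near=> j.
    have hax : 3 * h j < x - a by near: j; apply: h_near; rewrite subr_gt0.
    have hxb : 3 * h j < b - x by near: j; apply: h_near; rewrite subr_gt0.
    by rewrite /phi ramp1 ?ramp0 ?subr0 ?mulr1//; lra.
  - exact: integrable_abse.
  - apply: aeW => x j _; rewrite /= lee_fin normrM -[leRHS]mulr1.
    by rewrite ler_wpM2l.
  - by move=> _ _; apply.
have := cvg_v; under eq_fun => j.
  have -> : dphi j = derive1 (phi j).
    by apply/funext => x; rewrite derive1E; have [_ ->] := dphiP j x.
  rewrite (wd _ (test j)); over.
move=> cvg_v'.
have := cvg_unique _ cvg_v' (cvgN cvg_g).
by move=> /(_ (@Rhausdorff _)) vab; rewrite -[LHS]opprK -vab opprB.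
Unshelve. all: by end_near. Qed.

End weak_derivative.

Section primitive.
Variable R : realType.
Notation mu := (@lebesgue_measure R).
Variables (k : R -> R) (a b : R).
Hypothesis ik : mu.-integrable `]a, b[ (EFin \o k).

Definition primitive (t : R) : R := \int[mu]_(x in `]a, t[) k x.

Let ikS (x y : R) : a <= x -> y <= b -> mu.-integrable `]x, y[ (EFin \o k).
Proof.
move=> ax yb; apply: integrableS ik => //.
by apply: subset_itv; rewrite bnd_simp.
Qed.

Lemma primitive_left : primitive a = 0.
Proof. by rewrite /primitive set_itvoo0// Rintegral_set0. Qed.

Lemma primitiveB x y : a <= x -> x <= y -> y <= b ->
  primitive y - primitive x = \int[mu]_(t in `]x, y[) k t.
Proof.
move=> ax; rewrite le_eqVlt => /predU1P[<-|xy] yb.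
  by rewrite subrr set_itvoo0// Rintegral_set0.
have xb := ltW (lt_le_trans xy yb).
rewrite /primitive (Rintegral_itv_bndo_bndc (ikS (lexx a) xb)).
by rewrite Rintegral_itvB ?bnd_simp//; exact: ikS.
Qed.

(** The intervals are disjoint, so the increments add up to at most the integral of |k| over their
    union, which is small with the measure of the union. *)
Lemma primitive_abs_continuous : abs_continuous a b primitive.
Proof.
move=> e e0; pose K := k \_ `]a, b[.
have iK : mu.-integrable setT (EFin \o K).
  by rewrite -restrict_EFin; apply: (iffLR (integrable_mkcond _ _)).
have [d [d0 dP]] := integral_normr_continuous iK e0.
exists d => // N x y xy triv sd.
have xy3 i : [/\ a <= x i, x i <= y i & y i <= b] by exact: xy.
pose A := \big[setU/set0]_(i < N) `]x i, y i[%classic.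
have mA : measurable A by apply: bigsetU_measurable => i _.
have trivA : trivIset [set` index_enum 'I_N] (fun i => `]x i, y i[%classic).
  by apply: sub_trivIset triv.
have muA : mu A = (\sum_(i < N) (y i - x i))%:E.
  transitivity (\int[mu]_(t in A) cst 1%E t)%E.
    by rewrite integral_cst// mul1e.
  rewrite /A ge0_integral_bigsetU//; last exact: index_enum_uniq.
  rewrite -sumEFin; apply: eq_bigr => i _; rewrite integral_cst// mul1e.
  transitivity (mu `]x i, y i[%classic); first by [].
  rewrite lebesgue_measure_itv/= lte_fin.
  have [_ xyi _] := xy3 i; have [//|yx|->] := ltgtP (x i) (y i).
    by move: xyi; rewrite leNgt yx.
  by rewrite subrr.
apply: le_lt_trans (dP A mA _); last by rewrite [X in (X < _)%E]muA lte_fin.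
rewrite -lee_fin /Rintegral fineK; last first.
  apply: integrable_fin_num => //.
  apply: (@integrableS _ _ _ mu setT) => //; exact: (integrable_abse iK).
rewrite /A ge0_integral_bigsetU//; first last.
- apply: measurable_funTS; apply/measurable_EFinP/measurableT_comp => //.
  by apply/measurable_EFinP; exact: measurable_int iK.
- exact: index_enum_uniq.
rewrite -sumEFin; apply: lee_sum => i _; have [ax xyi yb] := xy3 i.
rewrite primitiveB//.
have ixy := ikS ax yb.
apply: (@le_trans _ _ (\int[mu]_(t in `]x i, y i[) `|k t|)%:E).
  by rewrite lee_fin le_normr_Rintegral.
rewrite /Rintegral fineK; last first.
  by apply: integrable_fin_num => //; exact: integrable_abse ixy.
rewrite le_eqVlt; apply/orP; left; apply/eqP; apply: eq_integral => t.
rewrite inE/= in_itv/= => /andP[xt ty].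
rewrite /K patchE mem_set//= in_itv/=.
by rewrite (le_lt_trans ax xt) (lt_le_trans ty yb).
Qed.

Lemma primitive_within_continuous : {within `[a, b], continuous primitive}.
Proof.
apply/subspace_continuousP => x; rewrite /= in_itv/= => /andP[ax xb].
apply/cvgrPdist_lt => e e0.
have [d d0 dP] := abs_continuous_dist primitive_abs_continuous e0.
apply/nbhs_ballP; exists d => //= y; rewrite -ball_normE/= => xyd.
rewrite in_itv/= => /andP[ay yb].
have [xy|yx] := leP x y.
  rewrite distrC; apply: dP => //.
  by rewrite -(ger0_norm (_ : 0 <= y - x)) ?subr_ge0// distrC.
apply: dP => //; first exact: ltW.
by rewrite -(ger0_norm (_ : 0 <= x - y)) ?subr_ge0// ltW.
Qed.

Lemma primitive_integrable : mu.-integrable `]a, b[ (EFin \o primitive).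
Proof.
apply: (@integrableS _ _ _ mu `[a, b]) => //; first exact: subset_itv_oo_cc.
apply: continuous_compact_integrable; first exact: segment_compact.
exact: primitive_within_continuous.
Qed.

(* Fubini on the triangle [a < s < t < b] for the function k(s) * phi'(t). *)
Lemma primitive_weak_derivative : weak_derivative a b primitive k.
Proof.
move=> phi [dphi cphi [c [d [ac db phi0]]]].
pose psi : R -> R := derive1 phi.
have psiP (x : R) : is_derive x 1 phi (psi x).
  by apply: DeriveDef; [exact: dphi|rewrite /psi derive1E].
have phib : phi b = 0 by apply: phi0; rewrite in_itv/= negb_and -!ltNge db orbT.
pose K := k \_ `]a, b[; pose P := psi \_ `]a, b[.
have iK : mu.-integrable setT (EFin \o K).
  by rewrite -restrict_EFin; apply: (iffLR (integrable_mkcond _ _)).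
have iP : mu.-integrable setT (EFin \o P).
  rewrite -restrict_EFin; apply: (iffLR (integrable_mkcond _ _)) => //.
  exact: continuous_integrable_oo.
have mK : measurable_fun setT K.
  by apply/measurable_EFinP; exact: measurable_int iK.
have mP : measurable_fun setT P.
  by apply/measurable_EFinP; exact: measurable_int iP.
(* The coordinates are (t, s). [F] is a product of integrable functions, and it dominates its
   restriction [G] to s < t, which justifies Fubini's theorem for [G]. *)
pose F (ts : R * R) : R := P ts.1 * K ts.2.
pose G (ts : R * R) : R := if ts.2 < ts.1 then F ts else 0.
have mF : measurable_fun setT F.
  by apply: measurable_funM; apply: measurableT_comp.
have mG : measurable_fun setT G.
  apply: measurable_fun_if => //.
  - by apply: measurable_fun_ltr.
  - exact: measurable_funTS.
have iF : (mu \x mu)%E.-integrable setT (EFin \o F).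
  apply/integrable12ltyP; first exact/measurable_EFinP.
  have -> : (\int[mu]_x \int[mu]_y `|(EFin \o F) (x, y)|)%E =
      (\int[mu]_x (`|P x|%:E * \int[mu]_y `|K y|%:E))%E.
    apply: eq_integral => x _; rewrite -ge0_integralZl_EFin//; last first.
      by apply/measurable_EFinP; exact: measurableT_comp.
    by apply: eq_integral => y _; rewrite /= normrM EFinM.
  have /integrableP[_ Koo] := iK; have /integrableP[_ Poo] := iP.
  have Kfin : (\int[mu]_y `|K y|%:E)%E \is a fin_num.
    by rewrite ge0_fin_numE// integral_ge0// => y _; rewrite lee_fin.
  have Pfin : (\int[mu]_x `|P x|%:E)%E \is a fin_num.
    by rewrite ge0_fin_numE// integral_ge0// => x _; rewrite lee_fin.
  rewrite -(fineK Kfin) ge0_integralZr//.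
  - by rewrite -(fineK Pfin) -EFinM ltry.
  - by apply/measurable_EFinP; exact: measurableT_comp.
  - by rewrite lee_fin fine_ge0// integral_ge0// => y _; rewrite lee_fin.
have iG : (mu \x mu)%E.-integrable setT (EFin \o G).
  apply: le_integrable iF => //; first exact/measurable_EFinP.
  move=> ts _; rewrite /= lee_fin /G; case: ifP => // _.
  by rewrite normr0.
have := Fubini iG.
have -> : (\int[mu]_x \int[mu]_y (EFin \o G) (x, y))%E =
    (\int[mu]_(t in `]a, b[) (primitive t * psi t)%:E)%E.
  rewrite [RHS]integral_mkcond; apply: eq_integral => t _.
  rewrite patchE; case: ifPn => [/set_mem/=|tab]; last first.
    rewrite integral0_eq// => s _.
    by rewrite /= /G /F/= {1}/P patchE (negbTE tab) mul0r if_same.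
  rewrite in_itv/= => /andP[at_ tb].
  have ikt := ikS (lexx a) (ltW tb).
  rewrite /primitive -RintegralZr// /Rintegral fineK; last first.
    apply: integrable_fin_num => //.
    by apply: (integrableZr _ _ ikt).
  rewrite [RHS]integral_mkcond; apply: eq_integral => s _.
  rewrite /= /G /F/= /P /K !patchE mem_set; last by rewrite /= in_itv/= at_.
  rewrite mulrC; case: ifPn => st.
    have [as_|as_] := boolP (a < s).
      by rewrite !mem_set//= in_itv/= as_// (lt_trans st tb).
    by rewrite !memNset ?mul0r//= in_itv/= (negbTE as_).
  by rewrite memNset//= in_itv/= (negbTE st) andbF.
have -> : (\int[mu]_y \int[mu]_x (EFin \o G) (x, y))%E =
    (\int[mu]_(s in `]a, b[) (- (k s * phi s))%:E)%E.
  rewrite [RHS]integral_mkcond; apply: eq_integral => s _.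
  rewrite patchE; case: ifPn => [/set_mem/=|sab]; last first.
    rewrite integral0_eq// => t _.
    by rewrite /= /G /F/= {1}/K patchE (negbTE sab) mulr0 if_same.
  rewrite in_itv/= => /andP[as_ sb].
  have ips := continuous_integrable_oo s b cphi.
  have -> : - (k s * phi s) = \int[mu]_(t in `]s, b[) (k s * psi t).
    by rewrite RintegralZl// (Rintegral_derive sb cphi psiP) phib sub0r mulrN.
  rewrite /Rintegral fineK; last first.
    by apply: integrable_fin_num => //; apply: (integrableZl _ _ ips).
  rewrite [RHS]integral_mkcond; apply: eq_integral => t _.
  rewrite /= /G /F/= /P /K !patchE [s \in _]mem_set; last first.
    by rewrite /= in_itv/= as_.
  case: ifPn => st; last by rewrite memNset//= in_itv/= (negbTE st).
  rewrite mulrC; have [tb|tb] := boolP (t < b).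
    by rewrite !mem_set//= in_itv/= ?st// (lt_trans as_ st).
  by rewrite !memNset ?mulr0//= in_itv/= (negbTE tb) andbF.
move=> E; rewrite /Rintegral E.
have ikp : mu.-integrable `]a, b[ (EFin \o (fun s => k s * phi s)).
  apply: integrableM_continuous ik => x.
  by apply: differentiable_continuous; apply/derivable1_diffP.
transitivity (\int[mu]_(s in `]a, b[) (-1 * (k s * phi s))); last first.
  by rewrite RintegralZl// mulN1r.
by congr fine; apply: eq_integral => s _; rewrite mulN1r.
Qed.

Lemma primitive_sobolev11 : sobolev11 a b primitive k.
Proof.
by split; [exact: primitive_integrable| |exact: primitive_weak_derivative].
Qed.

End primitive.

(** * The capacity of a weight *)

(** Young's inequality for [x] and 1 with the conjugate exponents [p] and [p / (p - 1)], multiplied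
    by [p]. *)
Lemma powR_bernoulli (R : realType) (x p : R) : 0 <= x -> 1 < p ->
  p * x - (p - 1) <= x `^ p.
Proof.
move=> x0 p1; have p0 : 0 < p by apply: lt_trans p1.
have q0 : 0 < p / (p - 1) by rewrite divr_gt0// subr_gt0.
have p10 : p - 1 != 0 by rewrite subr_eq0 gt_eqF.
have pq : p^-1 + (p / (p - 1))^-1 = 1 by field; rewrite p10 gt_eqF.
have := conjugate_powR x0 (ler01 : 0 <= (1 : R)) p0 q0 pq.
rewrite powR1 mulr1 -(ler_pM2l p0) mulrDr.
have -> : p * (x `^ p / p) = x `^ p by field; rewrite gt_eqF.
have -> : p * (1 / (p / (p - 1))) = p - 1 by field; rewrite p10 gt_eqF.
lra.
Qed.

(** Were the integral zero, [k] would vanish almost everywhere and the interval would be null. *)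
Lemma Rintegral_itv_gt0 (R : realType) (a b : R) (k : R -> R) : a < b ->
  (forall t, 0 < k t) ->
  lebesgue_measure.-integrable `]a, b[ (EFin \o k) ->
  0 < \int[lebesgue_measure]_(t in `]a, b[) k t.
Proof.
move=> hab k_gt0 k_int; set I := Rintegral _ _ _.
rewrite lt_def Rintegral_ge0 ?andbT; last by move=> t _; exact: ltW.
apply/eqP => I0.
have : ae_eq lebesgue_measure `]a, b[%classic (EFin \o k) (cst 0%E).
  apply/ae_eq_integral_abs => //; first exact: measurable_int k_int.
  under eq_integral do rewrite gee0_abs ?lee_fin ?(ltW (k_gt0 _))//.
  by rewrite -(fineK (integrable_fin_num _ k_int))// -[fine _]/I I0.
case=> N [mN N0 kN].
have : (lebesgue_measure `]a, b[%classic <= lebesgue_measure N)%E.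
  apply: le_measure; rewrite ?inE//= => t tab; apply: kN => /(_ tab)/=.
  by move=> [] /eqP; rewrite gt_eqF.
rewrite [lebesgue_measure N]N0 lebesgue_measure_itv/= lte_fin hab -EFinB lee_fin.
by rewrite subr_le0 leNgt hab.
Qed.

Section capacity.
Variables (R : realType) (n : nat) (Omega : set 'rV[R]_n).
Variables (theta : 'rV[R]_n -> R) (p a b : R) (k : R -> R).
Notation mu := (@lebesgue_measure R).

Lemma energy_weight_ge0 t : (0 <= energy_weight Omega theta p t)%E.
Proof. by apply: integral_ge0 => x _; rewrite lee_fin powR_ge0. Qed.

Hypotheses (hp : 1 < p) (hab : a < b).
Hypothesis k_gt0 : forall t, 0 < k t.
Hypothesis k_int : mu.-integrable `]a, b[ (EFin \o k).
Hypothesis weightE : {ae mu, forall t : R, a < t < b ->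
  energy_weight Omega theta p t = (k t `^ (- (p - 1)))%:E}.

Lemma energyE g : energy Omega theta p a b g =
  (\int[mu]_(t in `]a, b[) (`|g t| `^ p * k t `^ (- (p - 1)))%:E)%E.
Proof.
apply: ae_eq_ge0_integral.
- by move=> t _; rewrite mule_ge0 ?lee_fin ?powR_ge0 ?energy_weight_ge0.
- by move=> t _; rewrite lee_fin mulr_ge0 ?powR_ge0.
- move: weightE; apply: negligibleS => t; apply: contra_not => wE.
  rewrite /= in_itv/= => /wE ->.
  by rewrite EFinM.
Qed.

Let I := \int[mu]_(t in `]a, b[) k t.

Let I_gt0 : 0 < I.
Proof. exact: Rintegral_itv_gt0. Qed.

Let u t := k t * I^-1.
Let c := I^-1 `^ (p - 1).

Let u_gt0 t : 0 < u t.
Proof. by rewrite mulr_gt0// invr_gt0. Qed.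

Let u_int : mu.-integrable `]a, b[ (EFin \o u).
Proof. by apply: (integrableZr _ _ k_int). Qed.

Let int_u : \int[mu]_(t in `]a, b[) u t = 1.
Proof. by rewrite /u RintegralZr// -/I divff// gt_eqF. Qed.

(** The energy density of [u] is a constant multiple of [u] itself. This is what turns Bernoulli's
    inequality into a lower bound linear in [|g|] and [u], and gives [u] the energy [c]. *)
Let uE t : u t `^ p * k t `^ (- (p - 1)) = c * u t.
Proof.
have J0 : 0 < I^-1 by rewrite invr_gt0.
have kE : k t `^ p * k t `^ (- (p - 1)) = k t.
  rewrite -powRD; last by rewrite (gt_eqF (k_gt0 _)) implybT.
  by rewrite opprB addrC subrK powRr1// ltW.
have JE : I^-1 `^ p = c * I^-1.
  rewrite /c -[in X in _ * X](powRr1 (ltW J0)) -powRD ?subrK//.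
  by rewrite (gt_eqF J0) implybT.
by rewrite /u powRM ?(ltW (k_gt0 _)) ?(ltW J0)// mulrAC kE JE mulrCA.
Qed.

Let energy_lower (g : R -> R) t :
  c * (p * `|g t| - (p - 1) * u t) <= `|g t| `^ p * k t `^ (- (p - 1)).
Proof.
have c0 : 0 <= c by exact: powR_ge0.
have -> : `|g t| = (`|g t| / u t) * u t by rewrite divfK// gt_eqF.
set x := `|g t| / u t; have x0 : 0 <= x by rewrite divr_ge0// ltW.
rewrite powRM ?(ltW (u_gt0 _))// -[leRHS]mulrA uE [leRHS]mulrCA ler_wpM2l//.
rewrite mulrA -mulrBl ler_wpM2r ?(ltW (u_gt0 _))//.
exact: powR_bernoulli.
Qed.

Lemma capacity_weight : capacity Omega theta p a b =
  ((\int[mu]_(t in `]a, b[) k t) `^ (- (p - 1)))%:E.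
Proof.
rewrite -/I; have -> : I `^ (- (p - 1)) = c.
  by rewrite /c -[in RHS](powR_inv1 (ltW I_gt0)) -powRrM mulN1r.
apply/eqP; rewrite eq_le; apply/andP; split; last first.
  apply: le_ereal_inf_tmp => _ [v [g [[sob ac] va vb -> Eoo]]].
  have := sobolev11_FTC hab sob ac; rewrite va vb subr0 => g1.
  have [_ g_int _] := sob.
  have mg : measurable_fun `]a, b[ g.
    by apply/measurable_EFinP; exact: measurable_int g_int.
  have absg : 1 <= \int[mu]_(t in `]a, b[) `|g t|.
    by rewrite -g1; apply: le_trans (ler_norm _) _; exact: le_normr_Rintegral.
  have absg_int : mu.-integrable `]a, b[ (EFin \o (fun t => p * `|g t|)).
    by apply: (integrableZl _ p (integrable_abse g_int)).
  have pu_int : mu.-integrable `]a, b[ (EFin \o (fun t => (p - 1) * u t)).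
    by apply: (integrableZl _ (p - 1) u_int).
  have pgu_int : mu.-integrable `]a, b[
      (EFin \o (fun t => p * `|g t| - (p - 1) * u t)).
    by apply: (integrableB _ absg_int pu_int).
  have mk : measurable_fun `]a, b[ k.
    by apply/measurable_EFinP; exact: measurable_int k_int.
  pose e t := `|g t| `^ p * k t `^ (- (p - 1)).
  (* Finiteness of the energy of the competitor lets the pointwise bound be integrated among
     real-valued integrals. *)
  have e_int : mu.-integrable `]a, b[ (EFin \o e).
    apply/integrableP; split.
      apply/measurable_EFinP; apply: measurable_funM.
        apply: (measurableT_comp (measurable_powR p)).
        exact: measurableT_comp.
      exact: (measurableT_comp (measurable_powR _)).
    under eq_integral do rewrite gee0_abs ?lee_fin ?mulr_ge0 ?powR_ge0//.
    by rewrite energyE in Eoo.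
  rewrite energyE; apply: (@le_trans _ _ (\int[mu]_(t in `]a, b[)
      (c * (p * `|g t| - (p - 1) * u t)))%:E).
    rewrite lee_fin RintegralZl// -[leLHS]mulr1 ler_wpM2l ?powR_ge0//.
    rewrite RintegralB// !RintegralZl//; last exact: integrable_abse g_int.
    rewrite int_u; have := hp; nra.
  have -> : (\int[mu]_(t in `]a, b[) (`|g t| `^ p * k t `^ (- (p - 1)))%:E)%E =
      (\int[mu]_(t in `]a, b[) e t)%:E.
    by rewrite /Rintegral fineK//; exact: integrable_fin_num.
  rewrite lee_fin; apply: le_Rintegral => //.
  by apply: (integrableZl _ c pgu_int).
have Eu : energy Omega theta p a b u = c%:E.
  rewrite energyE; transitivity (\int[mu]_(t in `]a, b[) (c * u t))%:E.
    rewrite /Rintegral fineK; last first.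
      by apply: integrable_fin_num => //; apply: (integrableZl _ c u_int).
    by apply: eq_integral => t _; rewrite (ger0_norm (ltW (u_gt0 t))) uE.
  by rewrite RintegralZl// int_u mulr1.
apply: ereal_inf_lbound; exists (primitive u a), u; split.
- by split; [exact: primitive_sobolev11|exact: primitive_abs_continuous].
- exact: primitive_left.
- exact: int_u.
- by rewrite Eu.
- exact: ltry.
Qed.

End capacity.

(** * The weight on level sets and the conclusion *)

Lemma hausdorff_negligible (R : realType) n m (A : set 'rV[R]_n) :
  hausdorff_outer m A = 0%E -> (hausdorff R n m).-negligible A.
Proof.
(* Caratheodory's condition is automatic for a set of outer measure zero, so [A] is its own
   measurable null cover. *)
move=> A0; exists A; split => //; apply: le_caratheodory_measurable => X.
apply: (@le_trans _ _ (hausdorff_outer m A + hausdorff_outer m (X `&` ~` A))%E).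
  by rewrite leeD2r// le_outer_measure//; exact: subIsetr.
by rewrite A0 add0e le_outer_measure//; exact: subIsetl.
Qed.

Lemma energy_weight_cst (R : realType) (n : nat) (Omega : set 'rV[R]_n)
    (theta : 'rV[R]_n -> R) (p t c : R) :
  (@hausdorff_outer R n n.-1).-caratheodory (level_set Omega theta t) ->
  (hausdorff R n n.-1).-negligible
    (level_set Omega theta t `&` [set x | enorm (gradient theta x) <> c]) ->
  energy_weight Omega theta p t =
    ((c `^ (p - 1))%:E * level_area Omega theta t)%E.
Proof.
move=> mS negS; rewrite /energy_weight /level_area -integral_cst//.
apply: ae_eq_ge0_integral.
- by move=> x _; rewrite lee_fin powR_ge0.
- by move=> x _; rewrite /= lee_fin powR_ge0.
- apply: negligibleS negS => x /= /not_implyP[Sx xc]; split => // gc.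
  by apply: xc; rewrite gc.
Qed.

Section neg_power.
Variable R : realType.

Lemma neg_power_EFin (x s : R) : 0 < x ->
  neg_power x%:E s = (x `^ (- s))%:E.
Proof.
by move=> x0; rewrite /neg_power poweR_EFin inver gt_eqF ?powR_gt0// powRN.
Qed.

Lemma neg_power0 (s : R) : s != 0 -> neg_power 0%E s = +oo%E.
Proof. by move=> s0; rewrite /neg_power poweR_EFin powR0// inve0. Qed.

Lemma neg_power_gt0 (x s : R) : 0 < s -> 0 <= x -> (0 < neg_power x%:E s)%E.
Proof.
move=> s0; rewrite le_eqVlt => /predU1P[<-|x0].
  by rewrite neg_power0 ?gt_eqF// ltry.
by rewrite neg_power_EFin// lte_fin powR_gt0.
Qed.

(** With A = g^(p-1) s the product is A^(-1/(p-1)), and it is +oo when A = 0: both factors are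
    positive, so an infinite one is never multiplied by 0. *)
Lemma neg_powerM (g s p : R) : 1 < p -> 0 <= g -> 0 <= s ->
  (neg_power g%:E 1 * neg_power s%:E (p - 1)^-1)%E =
  (if 0 < g `^ (p - 1) * s then ((g `^ (p - 1) * s) `^ (- (p - 1)^-1))%:E
   else +oo%E).
Proof.
move=> p1; have p0 : 0 < p - 1 by rewrite subr_gt0.
have q0 : 0 < (p - 1)^-1 by rewrite invr_gt0.
rewrite le_eqVlt => /predU1P[<-|g0] s0.
  rewrite powR0 ?gt_eqF// mul0r ltxx neg_power0 ?oner_eq0//.
  by rewrite gt0_mulye// neg_power_gt0.
move: s0; rewrite le_eqVlt => /predU1P[<-|s0].
  by rewrite mulr0 ltxx neg_power0 ?gt_eqF// gt0_muley// neg_power_gt0// ltW.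
rewrite !neg_power_EFin// mulr_gt0 ?powR_gt0//.
rewrite -EFinM powRM ?powR_ge0 ?(ltW s0)//.
by rewrite -powRrM mulrN divff ?gt_eqF.
Qed.

End neg_power.

Theorem corollary4p2 (R : realType) (n : nat) (hn : (0 < n)%N)
    (Omega : set 'rV[R]_n) (Omega_open : open Omega)
    (Omega_bounded : bounded_set Omega)
    (p : R) (hp : 1 < p)
    (theta : 'rV[R]_n -> R)
    (theta_lipschitz : exists L : R, forall x y,
       closure Omega x -> closure Omega y ->
       `|theta x - theta y| <= L * enorm (x - y))
    (a b : R) (hab : a < b)
    (Gamma : R -> R)
    (Gamma_measurable :
       measurable_fun (`]a, b[%classic : set (lebesgue_type R)) Gamma)
    (Gamma_ge0 : forall t, a < t < b -> 0 <= Gamma t)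
    (gradient_eq : {ae lebesgueRn R n, forall x, Omega x ->
       a < theta x < b -> enorm (gradient theta x) = Gamma (theta x)}) :
  {ae lebesgue_measure, forall t : R, a < t < b ->
     energy_weight Omega theta p t =
     ((Gamma t `^ (p - 1))%:E * level_area Omega theta t)%E}
  /\
  let I := (\int[lebesgue_measure]_(t in `]a, b[)
     (neg_power (Gamma t)%:E 1 *
      neg_power (level_area Omega theta t) (p - 1)^-1))%E in
  ((I < +oo)%E -> capacity Omega theta p a b = neg_power I (p - 1)).
Proof.
have [L L0 thetaL] : exists2 L : R, 0 <= L & forall x y, Omega x -> Omega y ->
    `|theta x - theta y| <= L * enorm (x - y).
  have [L thetaL] := theta_lipschitz; exists `|L| => // x y Ox Oy.
  apply: le_trans (thetaL _ _ (subset_closure Ox) (subset_closure Oy)) _.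
  by rewrite ler_wpM2r ?enorm_ge0// ler_norm.
have weightE : {ae lebesgue_measure, forall t : R, a < t < b ->
    energy_weight Omega theta p t =
    ((Gamma t `^ (p - 1))%:E * level_area Omega theta t)%E}.
  pose N := Omega `&` [set x | a < theta x < b /\
    enorm (gradient theta x) <> Gamma (theta x)].
  have negN : (lebesgueRn R n).-negligible N.
    by apply: negligibleS gradient_eq => x [Ox [xab xG]] /(_ Ox xab).
  have NO : N `<=` Omega by move=> x [].
  have := null_slices hn L0 thetaL NO negN.
  apply: negligibleS => t; apply: contra_not => Nt tab.
  apply: energy_weight_cst.
    exact: (level_set_measurable Omega_open L0 thetaL).
  apply: negligibleS (hausdorff_negligible Nt) => x [[Ox tx] xG].
  by split => //; split => //=; rewrite tx.
split=> // I Ioo.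
have p10 : 0 < p - 1 by rewrite subr_gt0.
have r0 : 0 < (p - 1)^-1 by rewrite invr_gt0.
have mab : measurable (`]a, b[%classic : set R) by exact: measurable_itv.
pose S := level_area Omega theta.
have mS : measurable_fun setT S.
  exact: (level_area_measurable Omega_open L0 thetaL Omega_bounded).
have Sge0 t : (0 <= S t)%E by exact: hausdorff_outer_ge0.
have Sfin := finite_slices hn L0 thetaL Omega_bounded.
have [G mG GE] := lebesgue_measurable_fun_borel mab Gamma_measurable.
(* A real-valued Borel version of the weight, correct wherever [Gamma = G] and [S] is finite, that
   is, almost everywhere on the interval; [fine] turns an infinite area into 0. *)
pose w t := G t `^ (p - 1) * fine (S t).
have mw : measurable_fun setT w.
  apply: measurable_funM; first exact: (measurableT_comp (measurable_powR _)).
  by apply: measurableT_comp => //; exact: fine_measurable.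
(* The value 1 at zeros of [w] makes [k] positive everywhere; finiteness of [I] will show that these
   zeros form a null set in the interval. *)
pose k t := if 0 < w t then w t `^ (- (p - 1)^-1) else 1.
have k_gt0 t : 0 < k t by rewrite /k; case: ifP => // w0; rewrite powR_gt0.
have mlt : measurable_fun setT (fun t => 0 < w t).
  by apply: measurable_fun_ltr => //; exact: measurable_cst.
have mk : measurable_fun setT k.
  apply: measurable_fun_ifT => //.
  exact: (measurableT_comp (measurable_powR _)).
(* [J] keeps the value +oo at the zeros of [w], so it agrees almost everywhere with the integrand of
   [I] before anything is known about those zeros. *)
pose J t : \bar R := if 0 < w t then (k t)%:E else +oo%E.
have J0 t : (0 <= J t)%E by rewrite /J; case: ifP => // _; rewrite lee_fin ltW.
have mJ : measurable_fun setT J.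
  by apply: measurable_fun_ifT => //; exact/measurable_EFinP.
have good : {ae lebesgue_measure, forall t : R, a < t < b ->
    Gamma t = G t /\ S t = (fine (S t))%:E}.
  move: (negligibleU GE Sfin); apply: negligibleS => t; apply: contra_notP.
  move=> /not_orP[/contrapT Gt /contrapT St] tab; split.
    by apply: Gt; rewrite /= in_itv.
  by rewrite fineK// ge0_fin_numE.
have s0 t : 0 <= fine (S t) by exact: fine_ge0.
have IJ : I = (\int[lebesgue_measure]_(t in `]a, b[) J t)%E.
  apply: ae_eq_ge0_integral => //.
    move=> t; rewrite /= in_itv/= => tab.
    by rewrite mule_ge0// inve_ge0 poweR_ge0.
  move: good; apply: negligibleS => t; apply: contra_not => tgood.
  rewrite /= in_itv/= => tab; have [Gt St] := tgood tab.
  rewrite -/(S t) St neg_powerM ?Gamma_ge0// Gt -/(w t) /J /k.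
  by case: ifP.
have Jint : lebesgue_measure.-integrable `]a, b[ J.
  apply/integrableP; split; first exact: measurable_funTS.
  by under eq_integral do rewrite gee0_abs//; rewrite -IJ.
(* An integrable [J] is finite almost everywhere, and it is infinite exactly where [w] fails to be
   positive. *)
have wpos : {ae lebesgue_measure, forall t : R, a < t < b -> 0 < w t}.
  have := integrable_ae _ Jint; move=> /(_ mab).
  apply: negligibleS => t; apply: contra_not => Jt tab.
  have := Jt; rewrite /= in_itv/= => /(_ tab); rewrite /J.
  by case: ifP.
have kI : (\int[lebesgue_measure]_(t in `]a, b[) (k t)%:E)%E = I.
  rewrite IJ; apply: ae_eq_ge0_integral => //.
    by move=> t _; rewrite lee_fin ltW.
  move: wpos; apply: negligibleS => t; apply: contra_not => wt.
  by rewrite /= in_itv/= => /wt; rewrite /J => ->.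
have kint : lebesgue_measure.-integrable `]a, b[ (EFin \o k).
  apply/integrableP; split; first exact/measurable_EFinP/measurable_funTS.
  by under eq_integral do rewrite gee0_abs ?lee_fin ?(ltW (k_gt0 _))//; rewrite kI.
rewrite (capacity_weight hp hab k_gt0 kint).
  rewrite -neg_power_EFin; last exact: Rintegral_itv_gt0.
  by rewrite /Rintegral kI fineK// -kI; exact: integrable_fin_num.
(* It remains to see that the weight is [k] to the power -(p - 1): off three null sets it equals
   [w], and the exponents -1/(p - 1) and -(p - 1) cancel. *)
move: (negligibleU (negligibleU weightE wpos) good).
apply: negligibleS => t; apply: contra_notP.
move=> /not_orP[/not_orP[/contrapT At /contrapT wt] /contrapT tgood] tab.
have [Gt St] := tgood tab; rewrite (At tab) -/(S t) St -EFinM Gt -/(w t).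
rewrite /k (wt tab) -powRrM mulrNN mulVf ?gt_eqF// powRr1// ltW//.
exact: wt.
Qed.
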